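(* Let $F:(\mathbb{R}^2\times\mathbb{R}^3,0)\to(\mathbb{R},0)$ be an $\mathcal{R}^+$-versal unfolding of a function germ $f:(\mathbb{R}^2,0)\to(\mathbb{R},0)$ which is $\mathcal{R}$-equivalent to $u^3/3!+\varepsilon_1 uv^2/2$, where $\varepsilon_1\in\{1,-1\}$, and let $b=b_{\varepsilon_1,\varepsilon_2}$ ($\varepsilon_2\in\{1,-1\}$) be the parametrization of its bifurcation set (a $D_4^{\pm}$-singularity) described in the context. Then, near $\{z=0\}$, the two principal curvatures of $b$ on its set of regular points can be labelled $\kappa_1,\kappa_2$ so that $\kappa_2$ extends as a $C^\infty$ function across the set of singular points of $b$, while $\kappa_1$ is unbounded near the singular point of the bifurcation set (i.e. unbounded on the regular points of $b$ in every neighbourhood of $\{z=0\}$). Moreover, the principal directions corresponding to $\kappa_1$ and to $\kappa_2$ extend $C^\infty$-ly (as direction fields on the source of $b$) across the set of singular points of $b$.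
   Context: All maps and germs are $C^\infty$. Two germs $f_1,f_2:(\mathbb{R}^m,0)\to\mathbb{R}$ are $\mathcal{R}$-equivalent if $f_1=f_2\circ\varphi$ for a diffeomorphism germ $\varphi$ of $(\mathbb{R}^m,0)$. An unfolding of $f:(\mathbb{R}^m,0)\to\mathbb{R}$ is a germ $F:(\mathbb{R}^m\times\mathbb{R}^r,0)\to\mathbb{R}$ with $F(\mathbf u,0)=f(\mathbf u)$. An unfolding $F_1$ (with $r_1$ parameters) of $f$ is $\mathcal{R}^+$-versal if for every unfolding $F_2$ (with $r_2$ parameters) of $f$ there are germs $g:(\mathbb{R}^m\times\mathbb{R}^{r_2},0)\to(\mathbb{R}^m,0)$ with $g(\mathbf u,0)=\mathbf u$, $G:(\mathbb{R}^{r_2},0)\to(\mathbb{R}^{r_1},0)$, $h:(\mathbb{R}^{r_2},0)\to(\mathbb{R},0)$ with $F_2(\mathbf u,\mathbf x)=F_1(g(\mathbf u,\mathbf x),G(\mathbf x))+h(\mathbf x)$. The bifurcation set of $F$ is $\mathcal{B}_F=\{\mathbf x : \text{there is } \mathbf u \text{ with } \partial F/\partial u_i(\mathbf u,\mathbf x)=0 \text{ for all } i \text{ and } \operatorname{rank}(\partial^2F/\partial u_i\partial u_j)(\mathbf u,\mathbf x)<m\}$. Two such families $F_1,F_2$ are $P$-$\mathcal{R}^+$-isometric if $F_2(\mathbf u,\mathbf x)=F_1(g(\mathbf u,\mathbf x),G(\mathbf x))+h(\mathbf x)$ with $(\mathbf u,\mathbf x)\mapsto(g(\mathbf u,\mathbf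 x),G(\mathbf x))$ a diffeomorphism germ and $G$ an isometry germ of $(\mathbb{R}^3,0)$; bifurcation sets of $P$-$\mathcal{R}^+$-isometric families are related by an isometry of $\mathbb{R}^3$. Normal form. Write $(x,y,z)$ for the coordinates of $\mathbb{R}^3$. Every $F$ as in the claim is $P$-$\mathcal{R}^+$-isometric to $$\frac{u^3}{3!}+\varepsilon_1\frac{uv^2}{2}+P(x,y,z)u+Q(x,y,z)v+R(x,y,z)\frac{u^2-\varepsilon_1v^2}{2},$$ where $P,Q,R:(\mathbb{R}^3,0)\to(\mathbb{R},0)$ satisfy $P_y(0)=P_z(0)=Q_z(0)=0$ and $P_x(0),Q_y(0),R_z(0)>0$. The parametrization of the bifurcation set of $F$ is, up to this isometry of $\mathbb{R}^3$, the following parametrization for the normal form. Parametrization. Let $\varepsilon_2\in\{1,-1\}$. For $\varepsilon_1=-1$ put $\alpha(\theta)=\frac{\cos^22\theta-\sin^22\theta}{2}+\varepsilon_2\cos2\theta$, $\beta(\theta)=-\cos2\theta\sin2\theta+\varepsilon_2\sin2\theta$, $\theta\in\mathbb{R}/2\pi\mathbb{Z}$. For $\varepsilon_1=1$ put $\alpha(\theta)=\frac{\cosh^22\theta+\sinh^22\theta}{2}+\varepsilon_2\cosh2\theta$, $\beta(\theta)=\cosh2\theta\sinh2\theta-\varepsilon_2\sinh2\theta$, $\theta\in\mathbb{R}$. Let $X(\theta,x,y,z)=P+R^2\alpha(\theta)$, $Y(\theta,x,y,z)=Q+R^2\beta(\theta)$. By the implicit function theorem, for $(x,y,z)$ near $0$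 the equations $X=Y=0$ are solved uniquely by $C^\infty$ functions $x=x(\theta,z)$, $y=y(\theta,z)$ defined near $\{z=0\}$, and $$b_{\varepsilon_1,\varepsilon_2}(\theta,z)=(x(\theta,z),y(\theta,z),z).$$ (It parametrizes a double cover of the bifurcation set if $\varepsilon_1=-1$; if $\varepsilon_1=1$, $b_{1,1}$ and $b_{1,-1}$ together parametrize the bifurcation set except for its intersection curves.) All of $\{z=0\}$ is mapped to $0$, the singular point of the bifurcation set. The map $b$ has a globally defined $C^\infty$ unit normal field $\nu=\tilde\nu/|\tilde\nu|$, where, with $dX=(X_x,X_y,X_z)$, $dY=(Y_x,Y_y,Y_z)$ evaluated at $(\theta,x(\theta,z),y(\theta,z),z)$, $\tilde\nu=\sin\theta\,dX+\cos\theta\,dY$ for $(\varepsilon_1,\varepsilon_2)=(-1,1)$; $\tilde\nu=\cos\theta\,dX-\sin\theta\,dY$ for $(-1,-1)$; $\tilde\nu=-\cosh\theta\,dY+\sinh\theta\,dX$ for $(1,1)$; $\tilde\nu=-\sinh\theta\,dY+\cosh\theta\,dX$ for $(1,-1)$. Principal curvatures and directions are those of the regular part of $b$ with respect to $\nu$. *)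

(* Defs.v *)
(* Setting: MathComp-Analysis, over an arbitrary [K : realType]. *)
From HB Require Import structures.
From mathcomp Require Import all_boot all_order all_algebra.
From mathcomp Require Import all_classical all_reals all_analysis.

Set Implicit Arguments.
Unset Strict Implicit.
Unset Printing Implicit Defensive.

Import Order.TTheory GRing.Theory Num.Theory.
Import numFieldNormedType.Exports.

Local Open Scope classical_set_scope.
Local Open Scope ring_scope.

(* Germs at 0 are represented by total functions: smoothness is required, and
   identities are asserted, only on some neighbourhood of 0. *)

Section Smoothness.
Context {K : realType} {V W : normedModType K}.

(* [iter_derive [:: v1; ...; vk] f] is D_v1 (... (D_vk f)). *)
Definition iter_derive (vs : seq V) (f : V -> W) : V -> W :=
  foldr (fun v g x => 'D_v g x) f vs.

(* C^oo on the open set [U] of the finite-dimensional space [V]: every iterated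
   directional derivative exists and is differentiable, hence continuous. *)
Definition smooth_on (U : set V) (f : V -> W) : Prop :=
  forall (vs : seq V) (x : V), U x -> differentiable (iter_derive vs f) x.

Definition smooth_germ (f : V -> W) : Prop :=
  exists2 U : set V, open_nbhs 0 U & smooth_on U f.

End Smoothness.

Definition diffeo_germ (K : realType) (V : normedModType K) (phi : V -> V) : Prop :=
  [/\ smooth_germ phi, phi 0 = 0 &
    exists psi : V -> V,
      [/\ smooth_germ psi, psi 0 = 0,
          \forall x \near (0 : V), psi (phi x) = x &
          \forall x \near (0 : V), phi (psi x) = x]].

Section Euclidean.
Context {K : realType}.

Definition dot n (u v : 'rV[K]_n) : K := \sum_i u 0 i * v 0 i.

(* The library norm on ['rV[K]_n] is the sup norm; metric notions have to go
   through [dot] and [enorm]. *)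
Definition enorm n (u : 'rV[K]_n) : K := Num.sqrt (dot u u).

Definition isometry_germ n (G : 'rV[K]_n -> 'rV[K]_n) : Prop :=
  G 0 = 0 /\
  \forall p \near (0 : 'rV[K]_n) & q \near (0 : 'rV[K]_n),
    enorm (G p - G q) = enorm (p - q).

Definition partial n (i : 'I_n) (f : 'rV[K]_n -> K) (p : 'rV[K]_n) : K :=
  'D_(delta_mx 0 i) f p.

Definition grad n (f : 'rV[K]_n -> K) (p : 'rV[K]_n) : 'rV[K]_n :=
  \row_i partial i f p.

Definition vec2 (a b : K) : 'rV[K]_2 := \row_i [:: a; b]`_i.
Definition vec3 (a b c : K) : 'rV[K]_3 := \row_i [:: a; b; c]`_i.

End Euclidean.

Section Unfoldings.
Context {K : realType}.

Definition R_equivalent m (f1 f2 : 'rV[K]_m -> K) : Prop :=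
  exists2 phi : 'rV[K]_m -> 'rV[K]_m, diffeo_germ phi &
    \forall u \near (0 : 'rV[K]_m), f1 u = f2 (phi u).

Definition unfolding m r (f : 'rV[K]_m -> K) (F : 'rV[K]_m * 'rV[K]_r -> K) : Prop :=
  smooth_germ F /\ \forall u \near (0 : 'rV[K]_m), F (u, 0) = f u.

Definition Rplus_versal m r1 (f : 'rV[K]_m -> K)
    (F1 : 'rV[K]_m * 'rV[K]_r1 -> K) : Prop :=
  unfolding f F1 /\
  forall r2 (F2 : 'rV[K]_m * 'rV[K]_r2 -> K), unfolding f F2 ->
    exists (g : 'rV[K]_m * 'rV[K]_r2 -> 'rV[K]_m)
           (G : 'rV[K]_r2 -> 'rV[K]_r1) (h : 'rV[K]_r2 -> K),
      [/\ smooth_germ g /\ (\forall u \near (0 : 'rV[K]_m), g (u, 0) = u),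
          smooth_germ G /\ G 0 = 0,
          smooth_germ h /\ h 0 = 0 &
          \forall ux \near (0 : 'rV[K]_m * 'rV[K]_r2),
            F2 ux = F1 (g ux, G ux.2) + h ux.2].

Definition P_Rplus_isometric m r (F1 F2 : 'rV[K]_m * 'rV[K]_r -> K) : Prop :=
  exists (g : 'rV[K]_m * 'rV[K]_r -> 'rV[K]_m)
         (G : 'rV[K]_r -> 'rV[K]_r) (h : 'rV[K]_r -> K),
    [/\ diffeo_germ (fun ux : 'rV[K]_m * 'rV[K]_r => (g ux, G ux.2)),
        isometry_germ G,
        smooth_germ h &
        \forall ux \near (0 : 'rV[K]_m * 'rV[K]_r),
          F2 ux = F1 (g ux, G ux.2) + h ux.2].

End Unfoldings.

Section D4.
Context {K : realType}.
Implicit Types (e th : K) (P Q R : 'rV[K]_3 -> K) (q : 'rV[K]_2).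

Definition D4_germ e1 (u : 'rV[K]_2) : K :=
  u 0 0 ^+ 3 / 3`!%:R + e1 * (u 0 0 * u 0 1 ^+ 2 / 2).

Definition D4_family e1 P Q R (ux : 'rV[K]_2 * 'rV[K]_3) : K :=
  let u := ux.1 0 0 in let v := ux.1 0 1 in
  u ^+ 3 / 3`!%:R + e1 * (u * v ^+ 2 / 2)
  + P ux.2 * u + Q ux.2 * v + R ux.2 * ((u ^+ 2 - e1 * v ^+ 2) / 2).

Definition normal_coefs P Q R : Prop :=
  [/\ [/\ smooth_germ P, smooth_germ Q & smooth_germ R],
      [/\ P 0 = 0, Q 0 = 0 & R 0 = 0],
      [/\ partial 1 P 0 = 0, partial 2%:R P 0 = 0 & partial 2%:R Q 0 = 0] &
      [/\ 0 < partial 0 P 0, 0 < partial 1 Q 0 & 0 < partial 2%:R R 0]].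

Definition cosh th : K := (expR th + expR (- th)) / 2.
Definition sinh th : K := (expR th - expR (- th)) / 2.

(* The signs e1, e2 range over {1, -1}. *)

Definition alpha e1 e2 th : K :=
  if e1 == -1 then
    (cos (2 * th) ^+ 2 - sin (2 * th) ^+ 2) / 2 + e2 * cos (2 * th)
  else (cosh (2 * th) ^+ 2 + sinh (2 * th) ^+ 2) / 2 + e2 * cosh (2 * th).

Definition beta e1 e2 th : K :=
  if e1 == -1 then - (cos (2 * th) * sin (2 * th)) + e2 * sin (2 * th)
  else cosh (2 * th) * sinh (2 * th) - e2 * sinh (2 * th).

Definition Xfun e1 e2 P R th (p : 'rV[K]_3) : K := P p + R p ^+ 2 * alpha e1 e2 th.
Definition Yfun e1 e2 Q R th (p : 'rV[K]_3) : K := Q p + R p ^+ 2 * beta e1 e2 th.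

(* The source of b has coordinates (theta, z), theta in R/2piZ if e1 = -1 and
   in R if e1 = 1.  It is represented by the plane ['rV[K]_2]; when e1 = -1, all
   subsets and functions are required to be invariant under [turn]. *)
Definition turn q : 'rV[K]_2 := q + vec2 (2 * pi) 0.

Definition periodic_on (T : Type) e1 (U : set 'rV[K]_2) (f : 'rV[K]_2 -> T) : Prop :=
  e1 = -1 -> forall q, U q -> f (turn q) = f q.

Definition axis_nbhd e1 (U : set 'rV[K]_2) : Prop :=
  [/\ open U, forall th, U (vec2 th 0) &
      e1 = -1 -> forall q, U (turn q) <-> U q].

Definition bmap (x y : 'rV[K]_2 -> K) q : 'rV[K]_3 := vec3 (x q) (y q) (q 0 1).

(* x and y are the solutions given by the implicit function theorem; the values
   on {z = 0} select the branch near 0. *)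
Definition solves_XY e1 e2 P Q R (U : set 'rV[K]_2) (x y : 'rV[K]_2 -> K) : Prop :=
  [/\ axis_nbhd e1 U,
      smooth_on U x /\ smooth_on U y,
      periodic_on e1 U x /\ periodic_on e1 U y,
      forall th, x (vec2 th 0) = 0 /\ y (vec2 th 0) = 0 &
      forall q, U q -> Xfun e1 e2 P R (q 0 0) (bmap x y q) = 0 /\
                       Yfun e1 e2 Q R (q 0 0) (bmap x y q) = 0].

(* [bmap x y] on U is the parametrization b_(e1, e2) of the bifurcation set of
   F, written in the coordinates of R^3 in which F has the normal form with
   coefficients P, Q, R. *)
Definition bif_parametrization e1 e2 (F : 'rV[K]_2 * 'rV[K]_3 -> K) P Q R
    (U : set 'rV[K]_2) (x y : 'rV[K]_2 -> K) : Prop :=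
  [/\ normal_coefs P Q R,
      P_Rplus_isometric F (D4_family e1 P Q R) &
      solves_XY e1 e2 P Q R U x y].

Definition nu_tilde e1 e2 P Q R (b : 'rV[K]_2 -> 'rV[K]_3) q : 'rV[K]_3 :=
  let th := q 0 0 in
  let dX := grad (Xfun e1 e2 P R th) (b q) in
  let dY := grad (Yfun e1 e2 Q R th) (b q) in
  if e1 == -1 then
    if e2 == 1 then sin th *: dX + cos th *: dY else cos th *: dX - sin th *: dY
  else
    if e2 == 1 then - (cosh th *: dY) + sinh th *: dX
    else - (sinh th *: dY) + cosh th *: dX.

Definition nu e1 e2 P Q R (b : 'rV[K]_2 -> 'rV[K]_3) q : 'rV[K]_3 :=
  (enorm (nu_tilde e1 e2 P Q R b q))^-1 *: nu_tilde e1 e2 P Q R b q.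

End D4.

Section SurfaceGeometry.
Context {K : realType}.
Implicit Types (b n : 'rV[K]_2 -> 'rV[K]_3) (q : 'rV[K]_2).

(* Row-vector convention: row i of ['J b q] is the i-th partial derivative of b
   at q, and xi *m 'J b q = db_q(xi). *)

Definition regular_point b q : Prop := row_free ('J b q).

Definition first_form b q : 'M[K]_2 := 'J b q *m ('J b q)^T.

Definition second_form b n q : 'M[K]_2 := - ('J n q *m ('J b q)^T).

(* For q regular and n a unit normal, the matrix of the shape operator S defined
   by db(S xi) = - dn(xi), acting as xi |-> xi *m shape_operator b n q. *)
Definition shape_operator b n q : 'M[K]_2 := second_form b n q *m invmx (first_form b q).

Definition principal_curvatures b n q (k1 k2 : K) : Prop :=
  char_poly (shape_operator b n q) = ('X - k1%:P) * ('X - k2%:P).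

(* A direction field sends q to the row space of [D q], a line which is spanned,
   locally, by a nowhere zero smooth vector field.  It need not be globally
   orientable. *)
Definition smooth_direction_field (e1 : K) (V : set 'rV[K]_2)
    (D : 'rV[K]_2 -> 'M[K]_2) : Prop :=
  (forall p, V p ->
     exists (W : set 'rV[K]_2) (xi : 'rV[K]_2 -> 'rV[K]_2),
       [/\ open_nbhs p W, smooth_on W xi &
           forall q, W q -> xi q != 0 /\ (D q == xi q)%MS]) /\
  (e1 = -1 -> forall q, V q -> (D (turn q) == D q)%MS).

End SurfaceGeometry.

(* Main.v *)
Require Import Defs.
From HB Require Import structures.
From mathcomp Require Import all_boot all_order all_algebra.
From mathcomp Require Import ring.
From mathcomp Require Import all_classical all_reals all_analysis.
Import Order.TTheory GRing.Theory Num.Theory.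
Import numFieldNormedType.Exports.
Local Open Scope classical_set_scope.
Local Open Scope ring_scope.
Set Implicit Arguments.
Unset Strict Implicit.
Unset Printing Implicit Defensive.

(** Along {z = 0} the map b collapses to the origin, and b_theta = 0 wherever
    R * la = 0, where (alpha', beta') = la * (- n2, n1) and (n1, n2) are the
    coefficients of the conormal field n1 dX + n2 dY.  The point of the proof
    is that b_theta vanishes along a smooth nowhere zero direction.  Put
    E1 = (- nu_2, nu_1, 0), with nu = n1 dX + n2 dY the conormal field.
    Differentiating X = Y = 0 in theta and using Cramer's rule gives
    b_theta = mu * E1 with mu = - R^2 la / (X_x Y_y - X_y Y_x), which is smooth
    ([b_theta]), while E1 and b_z stay independent near the axis.  So b is a
    frontal with an adapted frame (E1, b_z), and b is regular exactly where
    mu <> 0 ([mu_regular]).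

    Because mixed derivatives commute ([derive_comm]), the factor mu comes out
    of the second fundamental form as well ([second_form_entries]):

      first form  = ( mu^2 g11   mu g12 )    second form = ( mu II11   mu II12 )
                    ( mu g12     g22    )                  ( mu II12   II22    )

    with all coefficients smooth on a neighbourhood of {z = 0}.  The
    determinant of (second form - kappa * first form) is, up to the factor
    mu * II11, the polynomial

      ratio * gram * kappa^2 - lin_coef * kappa + cst_coef,   ratio = mu / II11,

    whose leading coefficient vanishes at singular points while lin_coef
    is g22 > 0 there.  Hence one root stays smooth,
    kappa2 = 2 cst_coef / (lin_coef + root_disc), and the other one,
    kappa1 = (lin_coef + root_disc) / (2 ratio gram), is a positive smooth
    function divided by ratio.  Solving for the eigenvectors and clearing the
    denominator mu gives two smooth vector fields [direction1] and
    [direction2].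

    Two facts on the axis make this work.  There nu = (n1 P_x + n2 Q_x,
    n2 Q_y, 0), so that II11 is a nonzero multiple of the Wronskian of (n1, n2),
    which is 1 or -1 ([II11_axis]): the normal turns as theta moves although b
    does not.  And the derivative of R along b in the direction of z is
    R_z(0) > 0, so that points with mu <> 0 accumulate at the axis, where
    ratio tends to 0: kappa1 is unbounded ([kappa1_unbounded]).

    The angle theta enters through this Wronskian and through the factorization
    of (alpha', beta').  Both come from functions c, s with c' = e1 s, s' = c and
    c^2 - e1 s^2 = 1, that is, from (cos, sin) for e1 = -1 and (cosh, sinh) for
    e1 = 1 ([angular_plus], [angular_minus]). *)

(** * Smooth functions *)

Section Pointwise.
Context {K : realType} {V : normedModType K}.
Implicit Types (f g : V -> K) (q v : V).

Lemma derive_add f g q v : differentiable f q -> differentiable g q ->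
  'D_v (fun x => f x + g x) q = 'D_v f q + 'D_v g q.
Proof. by move=> df dg; apply: deriveD; exact: diff_derivable. Qed.

Lemma derive_mul f g q v : differentiable f q -> differentiable g q ->
  'D_v (fun x => f x * g x) q = 'D_v f q * g q + f q * 'D_v g q.
Proof.
move=> df dg; rewrite (_ : (fun _ => _) = f * g)// deriveM; try exact: diff_derivable.
by rewrite addrC; congr (_ + _); rewrite -[_ *: _]/(_ * _) mulrC.
Qed.

Lemma near0_differentiable (h : V -> K) q : (\forall x \near q, h x = 0) ->
  differentiable h q.
Proof.
move=> h0.
have hE : h \o shift q = cst (h q) + (\0 : {linear V -> K}) +o_ 0 id.
  apply/eqaddoP => e e0; move: (h0); rewrite (near_shift 0 q); apply: filterS => x /=.
  rewrite subr0 !fctE /= => ->; rewrite (nbhs_singleton h0) addr0 subrr normr0.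
  by rewrite mulr_ge0// ltW.
have d0 : 'd h q = (\0 : {linear V -> K}) :> (V -> K).
  by apply: diff_unique hE => x; exact: cst_continuous.
apply/diff_locallyP; rewrite d0; split=> // x; exact: cst_continuous.
Qed.

Lemma near_eq_differentiable f g q : (\forall x \near q, f x = g x) ->
  differentiable f q -> differentiable g q.
Proof.
move=> fg df; have -> : g = f + (g - f) by apply/funext => x /=; rewrite addrC subrK.
apply: differentiableD => //; apply: near0_differentiable.
by apply: filterS fg => x fgx; rewrite !fctE fgx subrr.
Qed.

Lemma derive_post (h : K -> K) (dh : K) f q v :
  differentiable f q -> is_derive (f q) 1 h dh ->
  differentiable (fun x => h (f x)) q /\
  'D_v (fun x => h (f x)) q = dh * 'D_v f q.
Proof.
move=> df [dh1 dhE].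
have dh2 : differentiable h (f q) by apply/derivable1_diffP.
have dhf : differentiable (h \o f) q by exact: differentiable_comp.
split=> //; rewrite [LHS]deriveE// diff_comp//= diff1E//.
by rewrite derive1E dhE deriveE// mulrC.
Qed.

Lemma derive_row n (F : V -> 'rV[K]_n) q v :
  (forall j, differentiable (fun x => F x 0 j) q) ->
  differentiable F q /\ forall j, ('D_v F q) 0 j = 'D_v (fun x => F x 0 j) q.
Proof.
move=> dF; have dFq : differentiable F q.
  have -> : F = \sum_(j < n) (fun x => F x 0 j *: delta_mx 0 j).
    by apply/funext => x; rewrite fct_sumE [LHS]row_sum_delta.
  by apply: differentiable_sum => j; exact: differentiableZl.
split=> // j; rewrite derive_mx ?mxE//; exact: diff_derivable.
Qed.

Lemma derive_comp n (P : 'rV[K]_n -> K) (b : V -> 'rV[K]_n) q v :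
  (forall j, differentiable (fun x => b x 0 j) q) ->
  differentiable P (b q) ->
  differentiable (fun x => P (b x)) q /\
  'D_v (fun x => P (b x)) q =
    \sum_(j < n) partial j P (b q) * 'D_v (fun x => b x 0 j) q.
Proof.
move=> db dP; have [dbq dbE] := derive_row v db.
have dPb : differentiable (P \o b) q by exact: differentiable_comp.
split=> //; rewrite [LHS]deriveE// diff_comp//= -(deriveE v dbq).
rewrite [X in 'd _ _ X]row_sum_delta linear_sum; apply: eq_bigr => j _.
by rewrite linearZ /= -deriveE// dbE mulrC.
Qed.

End Pointwise.

Section SmoothOn.
Context {K : realType} {V W : normedModType K}.
Implicit Types (U : set V) (f : V -> W).

Lemma smooth_on_diff U f x :
  smooth_on U f -> U x -> differentiable f x.
Proof. by move=> sf Ux; exact: (sf [::]). Qed.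

Lemma smooth_on_derive U f v :
  smooth_on U f -> smooth_on U ('D_v f).
Proof.
by move=> sf vs x Ux; have := sf (rcons vs v) x Ux; rewrite /iter_derive foldr_rcons.
Qed.

Lemma smooth_on_sub U U' (f : V -> W) :
  U' `<=` U -> smooth_on U f -> smooth_on U' f.
Proof. by move=> sU sf vs x /sU; exact: sf. Qed.

End SmoothOn.

Section SmoothClass.
Context {K : realType} {V : normedModType K}.
Implicit Types (U : set V) (f g : V -> K).

(** Smoothness asks for all iterated derivatives, so proving it one operation
    at a time would need a separate induction on the order for each of them.
    This class contains, together with a function, all its directional
    derivatives; differentiability of its members is then enough.  In [se_post]
    the sequence H lists the successive derivatives of the outer function. *)
Inductive smooth_expr U : (V -> K) -> Prop :=
| se_base f : smooth_on U f -> smooth_expr U f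
| se_eq f g : (forall x, U x -> f x = g x) -> smooth_expr U f -> smooth_expr U g
| se_cst c : smooth_expr U (fun=> c)
| se_add f g : smooth_expr U f -> smooth_expr U g -> smooth_expr U (fun x => f x + g x)
| se_mul f g : smooth_expr U f -> smooth_expr U g -> smooth_expr U (fun x => f x * g x)
| se_inv f : (forall x, U x -> f x != 0) -> smooth_expr U f ->
    smooth_expr U (fun x => (f x)^-1)
| se_sqrt f : (forall x, U x -> 0 < f x) -> smooth_expr U f ->
    smooth_expr U (fun x => Num.sqrt (f x))
| se_post (H : nat -> K -> K) n f : (forall i (t : K), is_derive t 1 (H i) (H i.+1 t)) ->
    smooth_expr U f -> smooth_expr U (fun x => H n (f x))
| se_comp n O (P : 'rV[K]_n -> K) (b : V -> 'rV[K]_n) :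
    smooth_on O P -> (forall x, U x -> O (b x)) ->
    (forall j, smooth_expr U (fun x => b x 0 j)) -> smooth_expr U (fun x => P (b x)).

Lemma smooth_expr_derive U f : open U -> smooth_expr U f ->
  (forall x, U x -> differentiable f x) /\ forall v, smooth_expr U ('D_v f).
Proof.
move=> oU; elim=> {f} [f sf|f g fg _ [df Df]|c|f g sf [df Df] sg [dg Dg]
  |f g sf [df Df] sg [dg Dg]|f f0 sf [df Df]|f f0 sf [df Df]|H n f HH sf [df Df]
  |n O P b sP bO sb IH].
- split=> [x|v]; first exact: smooth_on_diff.
  exact/se_base/smooth_on_derive.
- have nfg x : U x -> \forall y \near x, f y = g y.
    by move=> Ux; apply: filterS fg _; exact: open_nbhs_nbhs.
  split=> [x Ux|v].
    exact: near_eq_differentiable (nfg x Ux) (df x Ux).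
  apply: se_eq (Df v) => x Ux; exact/near_eq_derive/nfg.
- split=> [x _|v]; first exact: differentiable_cst.
  by apply: se_eq (se_cst _ 0) => x _; rewrite derive_cst.
- split=> [x Ux|v]; first by apply: differentiableD; [exact: df|exact: dg].
  apply: se_eq (se_add (Df v) (Dg v)) => x Ux; rewrite derive_add//; [exact: df|exact: dg].
- split=> [x Ux|v]; first by apply: differentiableM; [exact: df|exact: dg].
  apply: se_eq (se_add (se_mul (Df v) sg) (se_mul sf (Dg v))) => x Ux.
  by rewrite derive_mul//; [exact: df|exact: dg].
- have Hf v x Ux := derive_post v (df x Ux) (is_deriveV (f0 x Ux) (is_derive_id (f x) 1)).
  split=> [x Ux|v]; first by have [] := Hf 0 x Ux.
  apply: se_eq (se_mul (se_cst _ (-1))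
    (se_mul (se_mul (se_inv f0 sf) (se_inv f0 sf)) (Df v))) => x Ux.
  by have [_ ->] := Hf v x Ux; rewrite expr2 invfM -[_ *: _]/(_ * _); ring.
(* The derivative of a square root is an inverse of a square root, which the
   class already contains. *)
- have Hf v x Ux := derive_post v (df x Ux) (is_derive1_sqrt (f0 x Ux)).
  split=> [x Ux|v]; first by have [] := Hf 0 x Ux.
  have s0 x : U x -> 2 * Num.sqrt (f x) != 0.
    by move=> Ux; rewrite mulf_neq0 ?pnatr_eq0// gt_eqF// sqrtr_gt0 f0.
  apply: se_eq (se_mul (se_inv s0 (se_mul (se_cst _ 2) (se_sqrt f0 sf))) (Df v)) => x Ux.
  by have [_ ->] := Hf v x Ux.
- have Hf v x Ux := derive_post v (df x Ux) (HH n (f x)).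
  split=> [x Ux|v]; first by have [] := Hf 0 x Ux.
  apply: se_eq (se_mul (se_post n.+1 HH sf) (Df v)) => x Ux.
  by have [_ ->] := Hf v x Ux.
- have Hb v x (Ux : U x) := derive_comp v (fun j => (IH j).1 x Ux) (smooth_on_diff sP (bO x Ux)).
  split=> [x Ux|v]; first by have [] := Hb 0 x Ux.
  apply: (@se_eq _ (fun x => \sum_(j < n) partial j P (b x) * 'D_v (fun x => b x 0 j) x)).
    by move=> x Ux; have [_ ->] := Hb v x Ux.
  elim: (index_enum _) => [|j s IHs].
    by apply: se_eq (se_cst _ 0) => x _; rewrite big_nil.
  apply: se_eq (se_add (se_mul (@se_comp _ n O (partial j P) b _ bO sb) ((IH j).2 v)) IHs).
    by move=> x _; rewrite big_cons.
  exact: smooth_on_derive.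
Qed.

(** Iterated derivatives never leave [smooth_expr]. *)
Lemma smooth_exprP U f : open U -> smooth_expr U f -> smooth_on U f.
Proof.
move=> oU sf vs x Ux; suff sD : smooth_expr U (iter_derive vs f).
  exact: (smooth_expr_derive oU sD).1.
by elim: vs => //= v vs IH; exact: (smooth_expr_derive oU IH).2.
Qed.

End SmoothClass.

(** * Symmetry of mixed derivatives *)

Section Schwarz.
Context {K : realType} {V : normedModType K}.
Implicit Types (f : V -> K) (p u v : V).

Lemma is_derive_line f p u (s : K) : differentiable f (s *: u + p) ->
  is_derive s 1 (fun t => f (t *: u + p)) ('D_u f (s *: u + p)).
Proof.
move=> /(@diff_derivable _ _ _ _ _ u); rewrite /derivable => df.
have E : (fun h => h^-1 *: (((fun t => f (t *: u + p)) \o shift s) (h *: 1) - f (s *: u + p)))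
  = (fun h => h^-1 *: ((f \o shift (s *: u + p)) (h *: u) - f (s *: u + p))).
  by apply/funext => h /=; rewrite scalerDl addrA [_ *: 1]mulr1.
by split; rewrite /derivable /derive E.
Qed.

Lemma mean_value (phi dphi : K -> K) (h : K) : 0 < h ->
  (forall s, 0 <= s <= h -> is_derive s 1 phi (dphi s)) ->
  exists2 s, 0 <= s <= h & phi h - phi 0 = dphi s * h.
Proof.
move=> h0 dphiP.
have dI s : s \in `]0, h[%R -> is_derive s 1 phi (dphi s).
  by rewrite in_itv /= => /andP[s0 sh]; apply: dphiP; rewrite !ltW.
have cI : {within `[0, h], continuous phi}.
  apply: derivable_within_continuous => s; rewrite in_itv => hs.
  by have [] := dphiP s hs.
have [s + sE] := MVT h0 dI cI; rewrite in_itv /= => /andP[s0 sh].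
by exists s; [rewrite !ltW|rewrite sE subr0].
Qed.

(** Apply the mean value theorem first in the direction u, to the difference of
    two parallel translates, and then in the direction v. *)
Lemma second_difference f p u v (r h : K) :
  (forall w, smooth_on (ball p r) ('D_w f)) -> smooth_on (ball p r) f ->
  0 < h -> h * (`|u| + `|v|) < r ->
  exists2 y, `|p - y| <= h * (`|u| + `|v|) &
    f (h *: u + (h *: v + p)) - f (h *: u + p) - f (h *: v + p) + f p
      = h * h * 'D_v ('D_u f) y.
Proof.
move=> sDf sf h0 hr.
have near_p s t : 0 <= s <= h -> 0 <= t <= h ->
    `|p - (s *: u + (t *: v + p))| <= h * (`|u| + `|v|).
  move=> /andP[s0 sh] /andP[t0 th]; rewrite addrA opprD addrCA subrr addr0 normrN.
  rewrite (le_trans (ler_normD _ _))// !normrZ !ger0_norm// mulrDr.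
  by rewrite lerD// ler_wpM2r.
have inB s t : 0 <= s <= h -> 0 <= t <= h -> ball p r (s *: u + (t *: v + p)).
  move=> hs ht; rewrite -ball_normE /=; exact: le_lt_trans (near_p _ _ hs ht) hr.
have h00 : 0 <= (0 : K) <= h by rewrite lexx (ltW h0).
have hh : 0 <= h <= h by rewrite lexx (ltW h0).
pose phi s := f (s *: u + (h *: v + p)) - f (s *: u + p).
pose dphi s := 'D_u f (s *: u + (h *: v + p)) - 'D_u f (s *: u + p).
have dphiP s : 0 <= s <= h -> is_derive s 1 phi (dphi s).
  move=> hs; have i2 : ball p r (s *: u + p).
    by have := inB s 0 hs h00; rewrite scale0r add0r.
  apply: is_deriveB; apply: is_derive_line.
    exact: smooth_on_diff sf (inB _ _ hs hh).
  exact: smooth_on_diff sf i2.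
have [s hs phiE] := mean_value h0 dphiP.
pose psi t := 'D_u f (t *: v + (s *: u + p)).
pose dpsi t := 'D_v ('D_u f) (t *: v + (s *: u + p)).
have dpsiP t : 0 <= t <= h -> is_derive t 1 psi (dpsi t).
  move=> ht; apply: is_derive_line; apply: (smooth_on_diff (sDf u)).
  by rewrite addrCA; exact: inB.
have [t ht psiE] := mean_value h0 dpsiP.
exists (t *: v + (s *: u + p)); first by rewrite addrCA near_p.
move: phiE psiE; rewrite /phi /dphi /psi /dpsi !scale0r !add0r.
rewrite [s *: u + (h *: v + p)]addrCA => + psiE; rewrite psiE => phiE.
rewrite mulrAC [h * _]mulrC -phiE; ring.
Qed.

(** The second difference of f along u and v is symmetric in (u, v): by
    [second_difference] both mixed derivatives, each taken at some point close
    to p, are equal to it after division by h^2.  Conclude by continuity. *)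
Lemma derive_comm f (U : set V) p u v : open U -> U p -> smooth_on U f ->
  'D_u ('D_v f) p = 'D_v ('D_u f) p.
Proof.
move=> oU Up sf.
have [r /= r0 rU] : nbhs_ball p U by apply/nbhs_ballP/open_nbhs_nbhs.
have sfB : smooth_on (ball p r) f by exact: smooth_on_sub sf.
have sDB w : smooth_on (ball p r) ('D_w f) by exact/smooth_on_derive.
have cont a b : {for p, continuous ('D_a ('D_b f))}.
  apply: differentiable_continuous; apply: (@smooth_on_diff _ _ _ U) => //.
  exact/smooth_on_derive/smooth_on_derive.
apply/eqP; rewrite -subr_eq0 -normr_le0; apply/ler_addgt0Pr => e e0; rewrite add0r.
have e2 : 0 < e / 2 by rewrite divr_gt0.
have ctrl a b : exists2 d, 0 < d &
    forall y, `|p - y| < d -> `|'D_a ('D_b f) p - 'D_a ('D_b f) y| < e / 2.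
  have [d /= d0 B] : nbhs_ball p [set y | `|'D_a ('D_b f) p - 'D_a ('D_b f) y| < e / 2].
    by apply/nbhs_ballP; exact: (cvgrPdist_lt _ _).1 (cont a b) _ e2.
  by exists d => // y yd; apply: B; rewrite -ball_normE.
have [d1 d10 B1] := ctrl u v; have [d2 d20 B2] := ctrl v u.
pose m := Num.min r (Num.min d1 d2).
have m0 : 0 < m by rewrite !lt_min r0 d10.
pose h := m / (`|u| + `|v| + 1).
have n0 : 0 < `|u| + `|v| + 1 by rewrite ltr_wpDl// addr_ge0.
have h0 : 0 < h by rewrite divr_gt0.
have hm : h * (`|u| + `|v|) < m.
  by rewrite /h mulrAC ltr_pdivrMr// ltr_pM2l// ltrDl.
have hr : h * (`|u| + `|v|) < r by apply: lt_le_trans hm _; rewrite ge_min lexx.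
have [y yb yE] := second_difference sDB sfB h0 hr.
have [z zb zE] : exists2 z, `|p - z| <= h * (`|v| + `|u|) &
    f (h *: v + (h *: u + p)) - f (h *: v + p) - f (h *: u + p) + f p
      = h * h * 'D_u ('D_v f) z.
  by apply: second_difference sDB sfB h0 _; rewrite addrC.
have yz : 'D_u ('D_v f) z = 'D_v ('D_u f) y.
  apply: (@mulfI _ (h * h)); first by rewrite mulf_neq0 ?gt_eqF.
  move: yE zE; rewrite [h *: v + (h *: u + p)]addrCA.
  move: ('D_v ('D_u f) y) ('D_u ('D_v f) z) (f (h *: u + (h *: v + p))).
  move: (f (h *: u + p)) (f (h *: v + p)) (f p) => A B C D E G <- <-; ring.
rewrite [`|v| + _]addrC in zb.
have md1 : m <= d1 by rewrite /m !ge_min lexx orbT.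
have md2 : m <= d2 by rewrite /m !ge_min lexx !orbT.
have Bz := B1 z (lt_le_trans (le_lt_trans zb hm) md1).
have By := B2 y (lt_le_trans (le_lt_trans yb hm) md2).
rewrite yz in Bz; rewrite distrC in By.
apply: le_trans (ler_distD ('D_v ('D_u f) y) _ _) _.
rewrite (splitr e); apply: lerD; apply: ltW; [exact: Bz|exact: By].
Qed.

End Schwarz.

(** * Coordinates and functions on the source cylinder *)

Lemma smooth_on_row (K : realType) (V : normedModType K) n (U : set V) (F : V -> 'rV[K]_n) :
  open U -> (forall j, smooth_on U (fun q => F q 0 j)) -> smooth_on U F.
Proof.
move=> oU sF.
have H vs : forall x, U x -> forall j, iter_derive vs F x 0 j = iter_derive vs (fun q => F q 0 j) x.
  elim: vs => //= v vs IH x Ux j.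
  have E i : \forall z \near x, iter_derive vs (fun q => F q 0 i) z = iter_derive vs F z 0 i.
    by apply: filterS (open_nbhs_nbhs (conj oU Ux)) => z Uz; rewrite IH.
  have [_ ->] := derive_row v (fun i => near_eq_differentiable (E i) (sF i vs x Ux)).
  by apply/esym/near_eq_derive/E.
move=> vs x Ux.
have E i : \forall z \near x, iter_derive vs (fun q => F q 0 i) z = iter_derive vs F z 0 i.
  by apply: filterS (open_nbhs_nbhs (conj oU Ux)) => z Uz; rewrite H.
by have [] := derive_row 0 (fun i => near_eq_differentiable (E i) (sF i vs x Ux)).
Qed.

Lemma derive_coord (K : realType) n (i : 'I_n) (v q : 'rV[K]_n) :
  'D_v (fun p : 'rV[K]_n => p 0 i) q = v 0 i.
Proof.
by have [_ <-] := derive_row (F := id) v (fun j => differentiable_coord q 0 j); rewrite derive_id.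
Qed.

Lemma smooth_on_coord (K : realType) n (i : 'I_n) (U : set 'rV[K]_n) :
  smooth_on U (fun p : 'rV[K]_n => p 0 i).
Proof.
have H vs : iter_derive vs (fun p : 'rV[K]_n => p 0 i) = (fun p => p 0 i) \/
    exists c : K, iter_derive vs (fun p : 'rV[K]_n => p 0 i) = cst c.
  elim: vs => [|v vs [IH|[c IH]]]; first by left.
  - right; exists (v 0 i); rewrite /= IH; apply/funext => x; exact: derive_coord.
  - right; exists 0; rewrite /= IH; apply/funext => x; exact: derive_cst.
move=> vs x _; have [->|[c ->]] := H vs; first exact: differentiable_coord.
exact: differentiable_cst.
Qed.

Section Tame.
Context {K : realType} (e1 : K).
Implicit Types (U : set 'rV[K]_2) (f g : 'rV[K]_2 -> K).

(** The functions on the source of the parametrization: for e1 = -1 they have to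
    descend to the cylinder, and this is carried along with smoothness. *)
Definition tame U f := smooth_on U f /\ periodic_on e1 U f.

Lemma tame_sub U U' f : U' `<=` U -> tame U f -> tame U' f.
Proof.
move=> sU [sf pf]; split; first exact: smooth_on_sub sf.
by move=> e1N q /sU Uq; exact: pf.
Qed.

Lemma tame_cst U c : open U -> tame U (fun=> c).
Proof. by move=> oU; split=> //; apply: smooth_exprP => //; exact: se_cst. Qed.

Section OpenDomain.
Variables (U : set 'rV[K]_2) (oU : open U).

Lemma tame_add f g : tame U f -> tame U g -> tame U (fun q => f q + g q).
Proof.
move=> [sf pf] [sg pg]; split=> [|e1N q Uq]; last by rewrite pf ?pg.
by apply: smooth_exprP => //; apply: se_add; exact: se_base.
Qed.

Lemma tame_mul f g : tame U f -> tame U g -> tame U (fun q => f q * g q).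
Proof.
move=> [sf pf] [sg pg]; split=> [|e1N q Uq]; last by rewrite pf ?pg.
by apply: smooth_exprP => //; apply: se_mul; exact: se_base.
Qed.

Lemma tame_opp f : tame U f -> tame U (fun q => - f q).
Proof.
move=> tf; have := tame_mul (tame_cst (-1) oU) tf.
by congr tame; apply/funext => q; rewrite mulN1r.
Qed.

Lemma tame_exp f n : tame U f -> tame U (fun q => f q ^+ n).
Proof.
move=> tf; elim: n => [|n IH]; first exact: tame_cst.
have := tame_mul tf IH; by congr tame; apply/funext => q; rewrite exprS.
Qed.

Lemma tame_inv f : (forall q, U q -> f q != 0) -> tame U f -> tame U (fun q => (f q)^-1).
Proof.
move=> f0 [sf pf]; split=> [|e1N q Uq]; last by rewrite pf.
by apply: smooth_exprP => //; apply: se_inv => //; exact: se_base.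
Qed.

Lemma tame_sqrt f : (forall q, U q -> 0 < f q) -> tame U f -> tame U (fun q => Num.sqrt (f q)).
Proof.
move=> f0 [sf pf]; split=> [|e1N q Uq]; last by rewrite pf.
by apply: smooth_exprP => //; apply: se_sqrt => //; exact: se_base.
Qed.

Lemma tame_comp n O (P : 'rV[K]_n -> K) (b : 'rV[K]_2 -> 'rV[K]_n) :
  smooth_on O P -> (forall q, U q -> O (b q)) ->
  (forall j, tame U (fun q => b q 0 j)) -> tame U (fun q => P (b q)).
Proof.
move=> sP bO tb; split=> [|e1N q Uq].
  by apply: smooth_exprP => //; apply: se_comp sP bO _ => j; apply/se_base/(tb j).1.
by congr P; apply/rowP => j; rewrite (tb j).2.
Qed.

(** Directional derivatives commute with the translation [turn]. *)
Lemma tame_derive f v : tame U f -> tame U ('D_v f).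
Proof.
move=> [sf pf]; split=> [|e1N q Uq]; first exact: smooth_on_derive.
transitivity ('D_v (f \o @turn K) q).
  have E : (fun h => h^-1 *: ((f \o shift (turn q)) (h *: v) - f (turn q))) =
      (fun h => h^-1 *: (((f \o @turn K) \o shift q) (h *: v) - (f \o @turn K) q)).
    by apply/funext => h /=; rewrite /turn addrA.
  by rewrite /derive E.
have fE : \forall p \near q, (f \o @turn K) p = f p.
  by apply: filterS (open_nbhs_nbhs (conj oU Uq)) => p Up; exact: pf.
exact: near_eq_derive fE.
Qed.

End OpenDomain.

(** The domain of the principal data is cut out by finitely many positivity
    conditions; each of them is checked on the axis only, where everything is
    explicit. *)
Lemma axis_nbhd_pos U f : axis_nbhd e1 U -> tame U f ->
  (forall th, 0 < f (vec2 th 0)) -> axis_nbhd e1 [set q | U q /\ 0 < f q].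
Proof.
move=> [oU axU tU] [sf pf] f0; split=> [|th|e1N q] //=; last first.
  by split=> -[Uq fq]; have Uq' : U q by [apply/tU|]; [split=> //; rewrite -pf|
    split; [apply/tU|rewrite pf]].
rewrite openE => q /= [Uq fq]; apply: filterI; first exact: open_nbhs_nbhs.
have cf : {for q, continuous f} by apply/differentiable_continuous/(smooth_on_diff sf).
exact: cvgr_gt cf 0 fq.
Qed.

End Tame.

(** Hypotheses are compared syntactically: trying to unify two different
    functions would unfold the limits that define their derivatives. *)
Ltac tame_leaf := match goal with
  | H : tame _ ?V1 ?f1 |- tame _ ?V2 ?f2 => constr_eq V1 V2; constr_eq f1 f2; exact H
  end.

Ltac tame_tac := repeat lazymatch goal with
  | |- tame ?e ?V (fun q => ?f q) => change (tame e V f)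
  | |- tame _ _ (fun _ => ?c) => apply: tame_cst; eassumption
  | |- _ => first [tame_leaf | lazymatch goal with
    | |- tame ?e ?V (fun q => @?f q + @?g q) => apply: (@tame_add _ e V _ f g); first by eassumption
    | |- tame ?e ?V (fun q => @?f q * @?g q) => apply: (@tame_mul _ e V _ f g); first by eassumption
    | |- tame ?e ?V (fun q => @?f q ^+ ?n) => apply: (@tame_exp _ e V _ f n); first by eassumption
    | |- tame ?e ?V (fun q => - @?f q) => apply: (@tame_opp _ e V _ f); first by eassumption
    | |- tame ?e ?V (fun q => derive ?f q ?v) =>
        apply: (@tame_derive _ e V _ f v); first by eassumption
    end]
  end.

(** * Pencils of two by two matrices *)

Section TwoByTwo.
Context {F : fieldType}.
Implicit Types (A B S : 'M[F]_2) (xi : 'rV[F]_2).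

Lemma ord2E (i : 'I_2) : i = 0 \/ i = 1.
Proof. by case: i => -[|[|i]]// i2; [left|right]; apply/val_inj. Qed.

Lemma sum_ord2 (V : zmodType) (f : 'I_2 -> V) : \sum_i f i = f 0 + f 1.
Proof.
rewrite !big_ord_recl big_ord0 addr0; congr (_ + f _); exact/val_inj.
Qed.

Lemma det2 (R : comNzRingType) (A : 'M[R]_2) : \det A = A 0 0 * A 1 1 - A 0 1 * A 1 0.
Proof.
rewrite (expand_det_row _ 0) sum_ord2 /cofactor !det_mx11 !mxE /= expr0 expr1 mul1r mulN1r mulrN.
by congr (_ * A _ _ - _ * A _ _); apply/val_inj.
Qed.

Lemma char_poly2 S k1 k2 : k1 + k2 = S 0 0 + S 1 1 ->
  k1 * k2 = S 0 0 * S 1 1 - S 0 1 * S 1 0 ->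
  char_poly S = ('X - k1%:P) * ('X - k2%:P).
Proof.
move=> tr dt; rewrite /char_poly det2 !mxE /= !mulr1n !mulr0n !sub0r.
have : (k1 + k2)%:P = (S 0 0 + S 1 1)%:P :> {poly F} by rewrite tr.
have : (k1 * k2)%:P = (S 0 0 * S 1 1 - S 0 1 * S 1 0)%:P :> {poly F} by rewrite dt.
rewrite !(polyCB, polyCD, polyCM) => dtP trP.
transitivity ('X * 'X - ((S 0 0)%:P + (S 1 1)%:P) * 'X +
  ((S 0 0)%:P * (S 1 1)%:P - (S 0 1)%:P * (S 1 0)%:P)); first by ring.
by rewrite -dtP -trP; ring.
Qed.

(** Since the trace of S is k1 + k2 and k1 <> k2, S is not the scalar matrix k1,
    so the eigenspace of k1 is at most a line. *)
Lemma eigenspace_line S k1 k2 xi : k1 + k2 = S 0 0 + S 1 1 -> k1 != k2 ->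
  xi != 0 -> xi *m S = k1 *: xi -> (<<xi>> == eigenspace S k1)%MS.
Proof.
move=> tr k12 xi0 xiS; rewrite !genmxE.
have sub : (xi <= eigenspace S k1)%MS by apply/eigenspaceP.
rewrite -(geq_leqif (mxrank_leqif_eq sub)) rank_rV xi0 mxrank_ker.
have : (0 < \rank (S - k1%:M)%R)%N.
  rewrite lt0n mxrank_eq0; apply/eqP => /matrixP S0.
  have := S0 0 0; have := S0 1 1; rewrite !mxE /= !mulr1n => /eqP + /eqP.
  rewrite !subr_eq0 => /eqP S1 /eqP S2; move: tr; rewrite S1 S2 => /addrI /eqP.
  by rewrite eq_sym (negPf k12).
by rewrite leq_subLR addn1 ltnS.
Qed.

(** A and B are the second and first fundamental forms of a surface with frame
    (mu E1, E2).  The denominators mu in S show how it degenerates at singular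
    points. *)
Lemma shape_mx A B mu l m k g11 g12 g22 :
  A 0 0 = mu * l -> A 0 1 = mu * m -> A 1 0 = mu * m -> A 1 1 = k ->
  B 0 0 = mu * mu * g11 -> B 0 1 = mu * g12 -> B 1 0 = mu * g12 -> B 1 1 = g22 ->
  mu != 0 -> g11 * g22 - g12 * g12 != 0 ->
  let D := g11 * g22 - g12 * g12 in
  let S := A *m invmx B in
  [/\ S *m B = A, B \in unitmx,
      S 0 0 = (l * g22 / mu - m * g12) / D, S 1 1 = (k * g11 - m * g12) / D &
      S 0 0 * S 1 1 - S 0 1 * S 1 0 = (l * k / mu - m * m) / D].
Proof.
move=> A00 A01 A10 A11 B00 B01 B10 B11 mu0 D0 D S.
have uB : B \in unitmx.
  rewrite unitmxE det2 B00 B01 B10 B11 unitfE.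
  have -> : mu * mu * g11 * g22 - mu * g12 * (mu * g12) = mu * mu * D by rewrite /D; ring.
  by rewrite !mulf_neq0.
pose S0 : 'M[F]_2 := \matrix_(i, j)
  if i == 0 then if j == 0 then (l * g22 / mu - m * g12) / D else (mu * m * g11 - l * g12) / D
  else if j == 0 then (m * g22 - k * g12) / (mu * D) else (k * g11 - m * g12) / D.
have S0B : S0 *m B = A.
  apply/matrixP => i j; rewrite !mxE sum_ord2 !mxE /=.
  have [->|->] := ord2E i; have [->|->] := ord2E j;
  rewrite /= ?(A00, A01, A10, A11, B00, B01, B10, B11) /D; by field; rewrite ?mu0 ?D0.
have -> : S = S0 by rewrite /S -S0B mulmxK.
split=> //; rewrite !mxE //= /D; by field; rewrite ?mu0 ?D0.
Qed.

(** Eigenvectors of S = A B^-1 are found in the kernel of A - k B, where no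
    inverse occurs. *)
Lemma eigen_of_pencil S A B k xi : S *m B = A -> B \in unitmx ->
  xi 0 0 * (A 0 0 - k * B 0 0) + xi 0 1 * (A 1 0 - k * B 1 0) = 0 ->
  xi 0 0 * (A 0 1 - k * B 0 1) + xi 0 1 * (A 1 1 - k * B 1 1) = 0 ->
  xi *m S = k *: xi.
Proof.
move=> SB uB c0 c1; apply: (can_inj (mulmxK uB)); rewrite -mulmxA SB -scalemxAl.
apply/rowP => j; rewrite !mxE !sum_ord2; apply/eqP; rewrite -subr_eq0; apply/eqP.
by have [->|->] := ord2E j; [rewrite -[RHS]c0|rewrite -[RHS]c1]; ring.
Qed.

End TwoByTwo.

(** The two roots of t D k^2 - B k + C.  The second one is written with
    the sum B + s in the denominator instead of as (B - s) / (2 t D), so that it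
    makes sense when t = 0. *)
Lemma principal_values (F : fieldType) (l mu m k g11 g12 g22 s : F) :
  let D := g11 * g22 - g12 * g12 in
  let t := mu / l in
  let B := g22 + t * (k * g11 - 2 * m * g12) in
  let C := k - t * (m * m) in
  let k1 := (B + s) / (2 * (t * D)) in
  let k2 := 2 * C / (B + s) in
  l != 0 -> mu != 0 -> D != 0 -> B + s != 0 -> 2 != 0 :> F ->
  s * s = B * B - 4 * (t * D * C) ->
  [/\ k1 + k2 = (l * g22 / mu - m * g12) / D + (k * g11 - m * g12) / D,
      k1 * k2 = (l * k / mu - m * m) / D,
      k1 - k2 = s / (t * D) &
      forall a, a = k1 \/ a = k2 ->
      (l - a * (mu * g11)) * (k - a * g22) - mu * (m - a * g12) * (m - a * g12) = 0].
Proof.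
move=> D t B C k1 k2 l0 mu0 D0 Bs0 two0 ss.
have t0 : t != 0 by rewrite mulf_neq0 ?invr_eq0.
have B_def : B = g22 + t * (k * g11 - 2 * m * g12) by [].
have mu_def : mu = t * l by rewrite /t divfK.
have C_def : C = k - t * (m * m) by [].
have D_def : D = g11 * g22 - g12 * g12 by [].
clearbody B C D t.
have sum : k1 + k2 = B / (t * D).
  have : s * s + 4 * (t * D * C) = B * B by rewrite ss; ring.
  move=> {}ss; rewrite /k1 /k2.
  have -> : 2 * C / (B + s) = (B * B - s * s) / (2 * (t * D) * (B + s)).
    by rewrite -ss; field; rewrite two0 t0 D0 Bs0.
  by field; rewrite two0 t0 D0 Bs0.
have prod : k1 * k2 = C / (t * D) by rewrite /k1 /k2; field; rewrite two0 t0 D0 Bs0.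
split.
- by rewrite sum B_def mu_def; field; rewrite ?t0 ?D0 ?l0.
- by rewrite prod C_def mu_def; field; rewrite ?t0 ?D0 ?l0.
- apply: (@addrI _ (k1 + k2)); rewrite [in RHS]sum -mulrDl addrACA subrr addr0 /k1.
  by field; rewrite two0 t0 D0.
- move=> a ak.
  have : mu * D * ((a - k1) * (a - k2)) = 0 by case: ak => ->; rewrite subrr ?mul0r ?mulr0.
  move=> <-; have -> : (a - k1) * (a - k2) = a * a - a * (k1 + k2) + k1 * k2 by ring.
  rewrite sum prod B_def C_def mu_def D_def.
  by field; rewrite -?D_def ?t0 ?D0 ?l0.
Qed.

(** The right-hand sides are proportional to (n2, - n1), which makes (X, Y)
    proportional to the conormal n1 a + n2 b turned by a right angle. *)
Lemma cramer (F : fieldType) (a0 a1 a2 b0 b1 b2 n1 n2 r la X Y : F) :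
  let d := a0 * b1 - a1 * b0 in
  let mu := - (r * la) / d in
  d != 0 -> a0 * X + a1 * Y + a2 * 0 = r * (la * n2) * 1 ->
  b0 * X + b1 * Y + b2 * 0 = - (r * (la * n1) * 1) ->
  X = - (mu * (n1 * a1 + n2 * b1)) /\ Y = mu * (n1 * a0 + n2 * b0).
Proof.
move=> d mu d0; rewrite !mulr0 !addr0 !mulr1 => eX eY.
split; apply: (mulfI d0); rewrite /mu.
- transitivity (b1 * (a0 * X + a1 * Y) - a1 * (b0 * X + b1 * Y)); first by rewrite /d; ring.
  by rewrite eX eY; field.
- transitivity (a0 * (b0 * X + b1 * Y) - b0 * (a0 * X + a1 * Y)); first by rewrite /d; ring.
  by rewrite eX eY; field.
Qed.

(** For a root a of the pencil, (- (m - a g12), l - a mu g11) annihilates the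
    first column after division by mu, and the other vector comes from the second
    column.  The factor mu * a is kept together in the latter because only this
    product stays bounded when a is the unbounded root. *)
Lemma pencil_kernel (F : comNzRingType) (l mu m k g11 g12 g22 a : F) :
  (l - a * (mu * g11)) * (k - a * g22) - mu * (m - a * g12) * (m - a * g12) = 0 ->
  let c0 := mu * l - a * (mu * mu * g11) in
  let c := mu * m - a * (mu * g12) in
  let c1 := k - a * g22 in
  [/\ - (m - a * g12) * c0 + (l - a * (mu * g11)) * c = 0,
      - (m - a * g12) * c + (l - a * (mu * g11)) * c1 = 0,
      (mu * k - mu * a * g22) * c0 - mu * (mu * m - mu * a * g12) * c = 0 &
      (mu * k - mu * a * g22) * c - mu * (mu * m - mu * a * g12) * c1 = 0].
Proof.
move=> E c0 c c1; rewrite /c0 /c /c1; split; try by ring.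
- by rewrite -[RHS]E; ring.
- rewrite -[RHS](mulr0 (mu * mu)) -E; ring.
Qed.

(** * Differentiating the equations of the surface *)

Section Derivatives.
Context {K : realType}.

Lemma ord3E (i : 'I_3) : [\/ i = 0, i = 1 | i = 2%:R].
Proof.
by case: i => -[|[|[|i]]]// i3; [apply: Or31|apply: Or32|apply: Or33]; apply/val_inj.
Qed.

Lemma sum_ord3 (V : zmodType) (f : 'I_3 -> V) : \sum_i f i = f 0 + f 1 + f 2%:R.
Proof.
by rewrite !big_ord_recl big_ord0 addr0 -addrA; congr (_ + (f _ + f _)); apply/val_inj.
Qed.

Lemma vec2E0 (a b : K) : vec2 a b 0 0 = a. Proof. by rewrite mxE. Qed.
Lemma vec2E1 (a b : K) : vec2 a b 0 1 = b. Proof. by rewrite mxE. Qed.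
Lemma vec3E0 (a b c : K) : vec3 a b c 0 0 = a. Proof. by rewrite mxE. Qed.
Lemma vec3E1 (a b c : K) : vec3 a b c 0 1 = b. Proof. by rewrite mxE. Qed.
Lemma vec3E2 (a b c : K) : vec3 a b c 0 2%:R = c. Proof. by rewrite mxE. Qed.

Lemma mulmx_tr3 m (A B : 'M[K]_(m, 3)) i k :
  (A *m B^T) i k = A i 0 * B k 0 + A i 1 * B k 1 + A i 2%:R * B k 2%:R.
Proof. by rewrite mxE sum_ord3 !mxE. Qed.

Lemma jacobianE n m (F : 'rV[K]_n -> 'rV[K]_m) q i j :
  (forall j, differentiable (fun p => F p 0 j) q) ->
  ('J F q) i j = 'D_(delta_mx 0 i) (fun p => F p 0 j) q.
Proof.
move=> dF; have [dFq <-] := derive_row (delta_mx 0 i) dF.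
rewrite deriveEjacobian// -rowE. by rewrite [RHS]mxE.
Qed.

(** Product rule for a tangency relation: moves the derivative from the conormal
    (n0, n1, n2) to the tangent vector (f, g, c). *)
Lemma derive_relation (V : normedModType K) (n0 n1 n2 f g : V -> K) c q w :
  differentiable n0 q -> differentiable n1 q -> differentiable n2 q ->
  differentiable f q -> differentiable g q ->
  (\forall p \near q, n0 p * f p + n1 p * g p + n2 p * c = 0) ->
  'D_w n0 q * f q + 'D_w n1 q * g q + 'D_w n2 q * c = - (n0 q * 'D_w f q + n1 q * 'D_w g q).
Proof.
move=> d0 d1 d2 df dg zero.
have m0 : differentiable (fun p => n0 p * f p) q by exact: differentiableM.
have m1 : differentiable (fun p => n1 p * g p) q by exact: differentiableM.
have m2 : differentiable (fun p => n2 p * c) q by exact: differentiableM.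
have z : 'D_w (fun p => n0 p * f p + n1 p * g p + n2 p * c) q = 0.
  by rewrite (near_eq_derive w (g := cst 0) zero); exact: derive_cst.
move: z; rewrite derive_add//; last exact: differentiableD.
rewrite derive_add// !derive_mul// derive_cst mulr0 addr0 => z.
by apply/eqP; rewrite -addr_eq0 -[X in _ == X]z; apply/eqP; ring.
Qed.

Lemma derive_sqr (V : normedModType K) (f : V -> K) q v : differentiable f q ->
  'D_v (fun p => f p ^+ 2) q = 2 * f q * 'D_v f q.
Proof.
by move=> df; rewrite [LHS](derive_mul v df df); ring.
Qed.

Lemma differentiable_sqr (V : normedModType K) (f : V -> K) q : differentiable f q ->
  differentiable (fun p => f p ^+ 2) q.
Proof. by move=> df; have := differentiableX 1 df; rewrite exprfctE. Qed.

(** The common shape of X and Y at a fixed angle. *)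
Definition level (P R : 'rV[K]_3 -> K) (al : K) (p : 'rV[K]_3) := P p + R p ^+ 2 * al.

Lemma partial_level (P R : 'rV[K]_3 -> K) al p j :
  differentiable P p -> differentiable R p ->
  partial j (level P R al) p = partial j P p + 2 * R p * partial j R p * al.
Proof.
move=> dP dR; have dR2 := differentiable_sqr dR.
rewrite /partial /level derive_add//; last exact: differentiableM.
by rewrite derive_mul// derive_cst mulr0 addr0 derive_sqr.
Qed.

(** The equation holds along b at the varying angle theta; the second term is the
    contribution of the dependence of alpha on theta. *)
Lemma level_derive (P R : 'rV[K]_3 -> K) (al : K -> K) dal
    (b : 'rV[K]_2 -> 'rV[K]_3) (q v : 'rV[K]_2) :
  differentiable P (b q) -> differentiable R (b q) ->
  (forall j, differentiable (fun p => b p 0 j) q) ->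
  is_derive (q 0 0) 1 al dal ->
  (\forall p \near q, level P R (al ((p : 'rV[K]_2) 0 0)) (b p) = 0) ->
  \sum_j partial j (level P R (al (q 0 0))) (b q) * 'D_v (fun p => b p 0 j) q
    + R (b q) ^+ 2 * (dal * v 0 0) = 0.
Proof.
move=> dP dR db dalP zero.
have [dPb PbE] := derive_comp v db dP; have [dRb RbE] := derive_comp v db dR.
have [dalq alE] := derive_post v (differentiable_coord q 0 0) dalP.
have dR2 := differentiable_sqr dRb.
have zero' : 'D_v (fun p : 'rV[K]_2 => level P R (al (p 0 0)) (b p)) q = 0.
  by rewrite -(derive_cst (0 : K) q v); exact: near_eq_derive zero.
rewrite -[RHS]zero' /level derive_add//; last exact: differentiableM.
rewrite derive_mul// derive_sqr// PbE RbE alE derive_coord addrA; congr (_ + _).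
rewrite mulr_sumr mulr_suml -big_split; apply: eq_bigr => j _ /=.
rewrite -/(level P R _) partial_level//; ring.
Qed.

Lemma derive_axis (f : 'rV[K]_2 -> K) (h : K -> K) (dh th : K) :
  (forall t, f (vec2 t 0) = h t) -> is_derive th 1 h dh -> 'D_(delta_mx 0 0) f (vec2 th 0) = dh.
Proof.
move=> fh [_ <-].
have E : (fun s : K => s^-1 *: ((f \o shift (vec2 th 0)) (s *: delta_mx 0 0) - f (vec2 th 0))) =
  (fun s => s^-1 *: ((h \o shift th) (s *: 1) - h th)).
  apply/funext => s; rewrite /= -!fh; congr (_ *: (f _ - _)).
  by apply/rowP => j; rewrite !mxE; have [->|->] := ord2E j;
    rewrite /= ?(mulr1, mulr0) ?addr0 ?[_%:A]mulr1.
by rewrite /derive E.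
Qed.

End Derivatives.

(** * Principal curvatures near the axis *)

(** What the proof uses of the four pairs (alpha, beta): (alpha', beta') is la
    times a vector orthogonal to (n1, n2), and (n1, n2) turns at a nonzero
    speed. *)
Record angular (K : realType) (e1 : K) (al be n1 n2 la dn1 dn2 : K -> K) : Prop := Angular {
  ang_tame : let lift h := tame e1 setT (fun q => h (q 0 0)) in
    [/\ lift al, lift be, lift n1, lift n2 & lift la];
  ang_al : forall t : K, is_derive t 1 al (- (la t * n2 t));
  ang_be : forall t : K, is_derive t 1 be (la t * n1 t);
  ang_n1 : forall t : K, is_derive t 1 n1 (dn1 t);
  ang_n2 : forall t : K, is_derive t 1 n2 (dn2 t);
  ang_wronskian : forall t, n1 t * dn2 t - n2 t * dn1 t != 0;
  ang_nonzero : exists t, la t != 0 }.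

(* Unification must not unfold the limits behind derivatives. *)
Opaque derive.

Section Surface.
Context {K : realType} (e1 e2 : K) (P Q R : 'rV[K]_3 -> K) (U : set 'rV[K]_2).
Variables (x y : 'rV[K]_2 -> K) (n1 n2 la dn1 dn2 : K -> K).
Hypothesis hN : normal_coefs P Q R.
Variable O : set 'rV[K]_3.
Hypothesis hO : open_nbhs (0 : 'rV[K]_3) O.
Hypotheses (sP : smooth_on O P) (sQ : smooth_on O Q) (sR : smooth_on O R).
Hypothesis hS : solves_XY e1 e2 P Q R U x y.
Hypothesis hA : angular e1 (alpha e1 e2) (beta e1 e2) n1 n2 la dn1 dn2.

Notation b := (bmap x y).
Notation E i := (delta_mx 0 i : 'rV[K]_2).
Notation Dth f := ('D_(E 0) f).
Notation Dz f := ('D_(E 1) f).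

Definition gradX (j : 'I_3) (q : 'rV[K]_2) : K :=
  partial j P (b q) + 2 * R (b q) * partial j R (b q) * alpha e1 e2 (q 0 0).
Definition gradY (j : 'I_3) (q : 'rV[K]_2) : K :=
  partial j Q (b q) + 2 * R (b q) * partial j R (b q) * beta e1 e2 (q 0 0).
Definition conormal (j : 'I_3) (q : 'rV[K]_2) : K :=
  n1 (q 0 0) * gradX j q + n2 (q 0 0) * gradY j q.
Definition detXY (q : 'rV[K]_2) : K := gradX 0 q * gradY 1 q - gradX 1 q * gradY 0 q.

(** The factor by which b_theta is proportional to
    E1 = (- conormal 1, conormal 0, 0). *)
Definition mu (q : 'rV[K]_2) : K := - (R (b q) ^+ 2 * la (q 0 0)) / detXY q.
Definition conormal_sq (q : 'rV[K]_2) : K :=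
  conormal 0 q ^+ 2 + conormal 1 q ^+ 2 + conormal 2%:R q ^+ 2.
Definition conormal_inv (q : 'rV[K]_2) : K := (Num.sqrt (conormal_sq q))^-1.

(** The second fundamental form in the frame (E1, b_z), except that in [II11] the
    derivative of the normal in theta is not divided by mu. *)
Definition II11 (q : 'rV[K]_2) : K :=
  conormal_inv q *
    (Dth (conormal 0) q * conormal 1 q - Dth (conormal 1) q * conormal 0 q).
Definition II12 (q : 'rV[K]_2) : K :=
  conormal_inv q *
    (Dz (conormal 0) q * conormal 1 q - Dz (conormal 1) q * conormal 0 q).
Definition II22 (q : 'rV[K]_2) : K :=
  - (conormal_inv q *
    (Dz (conormal 0) q * Dz x q + Dz (conormal 1) q * Dz y q + Dz (conormal 2%:R) q)).

(** The Gram matrix of the frame (E1, b_z). *)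
Definition g11 (q : 'rV[K]_2) : K :=
  conormal 0 q * conormal 0 q + conormal 1 q * conormal 1 q.
Definition g12 (q : 'rV[K]_2) : K := - conormal 1 q * Dz x q + conormal 0 q * Dz y q.
Definition g22 (q : 'rV[K]_2) : K := Dz x q * Dz x q + Dz y q * Dz y q + 1.
Definition gram (q : 'rV[K]_2) : K := g11 q * g22 q - g12 q * g12 q.

(** The determinant of (second form - kappa * first form), divided by mu * II11, is
    ratio * gram * kappa^2 - lin_coef * kappa + cst_coef. *)
Definition ratio (q : 'rV[K]_2) : K := mu q / II11 q.
Definition lin_coef (q : 'rV[K]_2) : K :=
  g22 q + ratio q * (II22 q * g11 q - 2 * II12 q * g12 q).
Definition cst_coef (q : 'rV[K]_2) : K := II22 q - ratio q * (II12 q * II12 q).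
Definition disc (q : 'rV[K]_2) : K :=
  lin_coef q * lin_coef q - 4 * (ratio q * gram q * cst_coef q).
Definition root_disc (q : 'rV[K]_2) : K := Num.sqrt (disc q).
Definition kappa1 (q : 'rV[K]_2) : K :=
  (lin_coef q + root_disc q) / (2 * (ratio q * gram q)).
Definition kappa2 (q : 'rV[K]_2) : K := 2 * cst_coef q / (lin_coef q + root_disc q).

(** The product mu * kappa1, in a form that is smooth at singular points. *)
Definition mu_kappa1 (q : 'rV[K]_2) : K :=
  II11 q * (lin_coef q + root_disc q) / (2 * gram q).
Definition direction1 (q : 'rV[K]_2) : 'rV[K]_2 :=
  vec2 (mu q * II22 q - mu_kappa1 q * g22 q)
    (- (mu q * (mu q * II12 q - mu_kappa1 q * g12 q))).
Definition direction2 (q : 'rV[K]_2) : 'rV[K]_2 :=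
  vec2 (- (II12 q - kappa2 q * g12 q)) (II11 q - kappa2 q * (mu q * g11 q)).

Definition V1 : set 'rV[K]_2 := [set q | U q /\ O (b q)].

Let axU : axis_nbhd e1 U. Proof. by case: hS. Qed.
Let oU : open U. Proof. by case: axU. Qed.
Let tx : tame e1 U x. Proof. by case: hS => _ [? _] [? _]. Qed.
Let ty : tame e1 U y. Proof. by case: hS => _ [_ ?] [_ ?]. Qed.

Lemma tame_b j : tame e1 U (fun q => b q 0 j).
Proof.
have [->|->|->] := ord3E j; under eq_fun do rewrite ?(vec3E0, vec3E1, vec3E2).
- exact: tx.
- exact: ty.
- split; first exact: smooth_on_coord.
  by move=> _ q _; rewrite /turn mxE vec2E1 addr0.
Qed.

Lemma b_axis th : b (vec2 th 0) = 0.
Proof.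
have [_ _ _ xy _] := hS; have [x0 y0] := xy th.
apply/rowP => j; rewrite [RHS]mxE.
by have [->|->|->] := ord3E j; rewrite ?(vec3E0, vec3E1, vec3E2) ?vec2E1.
Qed.

Lemma b_turn q : e1 = -1 -> U q -> b (turn q) = b q.
Proof. by move=> e1N Uq; apply/rowP => j; rewrite (tame_b j).2. Qed.

Lemma axis_V1 : axis_nbhd e1 V1.
Proof.
have [_ ax tU] := axU; have [oO O0] := hO.
split=> [|th|e1N q]; last 1 first.
- by split=> -[Uq Oq]; have Uq' : U q by [|apply/tU|];
    (split; [exact/tU|rewrite ?b_turn// -b_turn]).
- rewrite openE => q /= [Uq Oq]; apply: filterI; first exact: open_nbhs_nbhs.
  have [db _] := derive_row 0 (fun j => smooth_on_diff (tame_b j).1 Uq).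
  exact: (differentiable_continuous db (open_nbhs_nbhs (conj oO Oq))).
- by split; [exact: ax|rewrite b_axis].
Qed.

Let oV1 : open V1. Proof. by case: axis_V1. Qed.
Let V1U : V1 `<=` U. Proof. by move=> q []. Qed.
Let bO q : V1 q -> O (b q). Proof. by case. Qed.

Lemma tame_ang : let lift h := tame e1 V1 (fun q => h (q 0 0)) in
  [/\ lift (alpha e1 e2), lift (beta e1 e2), lift n1, lift n2 & lift la].
Proof. by case: (ang_tame hA) => *; split; exact: tame_sub (@subsetT _ V1) _. Qed.

Lemma tame_coef G : smooth_on O G -> tame e1 V1 (fun q => G (b q)).
Proof. by move=> sG; apply: tame_comp sG bO _ => // j; exact: tame_sub (tame_b j). Qed.

Lemma tame_partial G j : smooth_on O G -> tame e1 V1 (fun q => partial j G (b q)).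
Proof. by move=> sG; apply: (@tame_coef (partial j G)); exact: smooth_on_derive. Qed.

Lemma tame_gradX j : tame e1 V1 (gradX j).
Proof.
have [ta _ _ _ _] := tame_ang; have tR := tame_coef sR.
by have tP := tame_partial j sP; have tRj := tame_partial j sR; rewrite /gradX /gradY; tame_tac.
Qed.

Lemma tame_gradY j : tame e1 V1 (gradY j).
Proof.
have [_ tb _ _ _] := tame_ang; have tR := tame_coef sR.
by have tQ := tame_partial j sQ; have tRj := tame_partial j sR; rewrite /gradX /gradY; tame_tac.
Qed.

Lemma tame_conormal j : tame e1 V1 (conormal j).
Proof.
have [_ _ t1 t2 _] := tame_ang.
by have tX := tame_gradX j; have tY := tame_gradY j; rewrite /conormal; tame_tac.
Qed.

Lemma tame_detXY : tame e1 V1 detXY.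
Proof.
have X0 := tame_gradX 0; have X1 := tame_gradX 1; have Y0 := tame_gradY 0; have Y1 := tame_gradY 1.
by rewrite /detXY; tame_tac.
Qed.

Let b0 : (fun q => b q 0 0) = x. Proof. by apply/funext => q; rewrite vec3E0. Qed.
Let b1 : (fun q => b q 0 1) = y. Proof. by apply/funext => q; rewrite vec3E1. Qed.
Let b2 : (fun q => b q 0 2%:R) = (fun q => q 0 1).
Proof. by apply/funext => q; rewrite vec3E2. Qed.

Let dP q : V1 q -> differentiable P (b q). Proof. by move=> [_ Oq]; exact: smooth_on_diff Oq. Qed.
Let dQ q : V1 q -> differentiable Q (b q). Proof. by move=> [_ Oq]; exact: smooth_on_diff Oq. Qed.
Let dR q : V1 q -> differentiable R (b q). Proof. by move=> [_ Oq]; exact: smooth_on_diff Oq. Qed.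
Let db q : V1 q -> forall j, differentiable (fun p => b p 0 j) q.
Proof. by move=> [Uq _] j; exact: smooth_on_diff (tame_b j).1 Uq. Qed.

Lemma gradXE j q : V1 q -> gradX j q = partial j (Xfun e1 e2 P R (q 0 0)) (b q).
Proof. by move=> Vq; rewrite [RHS]partial_level//; [exact: dP|exact: dR]. Qed.

Lemma gradYE j q : V1 q -> gradY j q = partial j (Yfun e1 e2 Q R (q 0 0)) (b q).
Proof. by move=> Vq; rewrite [RHS]partial_level//; [exact: dQ|exact: dR]. Qed.

(** The ring tactics compare atoms up to conversion, which unfolds the limits
    defining the derivatives; the atoms are therefore turned into variables
    first. *)
Ltac gen_atoms := repeat match goal with
  | |- context [derive ?f ?p ?v] => generalize (derive f p v)
  | |- context [gradX ?j ?p] => generalize (gradX j p)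
  | |- context [gradY ?j ?p] => generalize (gradY j p)
  | |- context [conormal ?j ?p] => generalize (conormal j p)
  | |- context [detXY ?p] => generalize (detXY p)
  | |- context [partial ?j ?f ?p] => generalize (partial j f p)
  | |- context [conormal_inv ?p] => generalize (conormal_inv p)
  | |- context [mu ?p] => generalize (mu p)
  | |- context [n1 ?p] => generalize (n1 p)
  | |- context [n2 ?p] => generalize (n2 p)
  | |- context [la ?p] => generalize (la p)
  | |- context [dn1 ?p] => generalize (dn1 p)
  | |- context [dn2 ?p] => generalize (dn2 p)
  | |- context [R ?p] => generalize (R p) end; intros.

Lemma X_derive q v : V1 q ->
  gradX 0 q * 'D_v x q + gradX 1 q * 'D_v y q + gradX 2%:R q * v 0 1 =
    R (b q) ^+ 2 * (la (q 0 0) * n2 (q 0 0)) * v 0 0.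
Proof.
move=> Vq; have [_ _ _ _ XY] := hS.
have zero : \forall p \near q, level P R (alpha e1 e2 ((p : 'rV[K]_2) 0 0)) (b p) = 0.
  by apply: filterS (open_nbhs_nbhs (conj oU Vq.1)) => p /XY[].
have := level_derive v (dP Vq) (dR Vq) (db Vq) (ang_al hA (q 0 0)) zero.
rewrite sum_ord3 b0 b1 b2 derive_coord -!/(Xfun e1 e2 P R (q 0 0)) -!gradXE//.
by move/eqP; rewrite addr_eq0 => /eqP ->; gen_atoms; ring.
Qed.

Lemma Y_derive q v : V1 q ->
  gradY 0 q * 'D_v x q + gradY 1 q * 'D_v y q + gradY 2%:R q * v 0 1 =
    - (R (b q) ^+ 2 * (la (q 0 0) * n1 (q 0 0)) * v 0 0).
Proof.
move=> Vq; have [_ _ _ _ XY] := hS.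
have zero : \forall p \near q, level Q R (beta e1 e2 ((p : 'rV[K]_2) 0 0)) (b p) = 0.
  by apply: filterS (open_nbhs_nbhs (conj oU Vq.1)) => p /XY[].
have := level_derive v (dQ Vq) (dR Vq) (db Vq) (ang_be hA (q 0 0)) zero.
rewrite sum_ord3 b0 b1 b2 derive_coord -!/(Yfun e1 e2 Q R (q 0 0)) -!gradYE//.
by move/eqP; rewrite addr_eq0 => /eqP ->; gen_atoms; ring.
Qed.

(** The terms of [X_derive] and [Y_derive] that come from theta cancel, since
    (alpha', beta') is orthogonal to (n1, n2). *)
Lemma conormal_tangent q v : V1 q ->
  conormal 0 q * 'D_v x q + conormal 1 q * 'D_v y q + conormal 2%:R q * v 0 1 = 0.
Proof.
move=> Vq; have X := X_derive v Vq; have Y := Y_derive v Vq.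
transitivity (n1 (q 0 0) * (gradX 0 q * 'D_v x q + gradX 1 q * 'D_v y q + gradX 2%:R q * v 0 1)
  + n2 (q 0 0) * (gradY 0 q * 'D_v x q + gradY 1 q * 'D_v y q + gradY 2%:R q * v 0 1)).
  by rewrite /conormal; gen_atoms; ring.
by rewrite X Y; gen_atoms; ring.
Qed.

Let e00 : (E 0) 0 0 = 1. Proof. by rewrite mxE. Qed.
Let e01 : (E 0) 0 1 = 0. Proof. by rewrite mxE. Qed.
Let e10 : (E 1) 0 0 = 0. Proof. by rewrite mxE. Qed.
Let e11 : (E 1) 0 1 = 1. Proof. by rewrite mxE. Qed.

(** The derivative b_theta is orthogonal to the conormal and horizontal, hence a
    multiple of E1; Cramer's rule gives the multiple. *)
Lemma b_theta q : V1 q -> detXY q != 0 ->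
  Dth x q = - (mu q * conormal 1 q) /\ Dth y q = mu q * conormal 0 q.
Proof.
move=> Vq d0; have X := X_derive (E 0) Vq; have Y := Y_derive (E 0) Vq.
by rewrite e00 e01 in X Y; have [-> ->] := cramer d0 X Y; split; rewrite /mu /conormal.
Qed.

Let R0 : R 0 = 0. Proof. by case: hN => _ []. Qed.

Lemma gradX_axis j th : gradX j (vec2 th 0) = partial j P 0.
Proof. by rewrite /gradX b_axis R0 mulr0 !mul0r addr0. Qed.

Lemma gradY_axis j th : gradY j (vec2 th 0) = partial j Q 0.
Proof. by rewrite /gradY b_axis R0 mulr0 !mul0r addr0. Qed.

Lemma conormal_axis th : [/\ conormal 0 (vec2 th 0) = n1 th * partial 0 P 0 + n2 th * partial 0 Q 0,
  conormal 1 (vec2 th 0) = n2 th * partial 1 Q 0 & conormal 2%:R (vec2 th 0) = 0].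
Proof.
have [_ _ [P1 P2 Q2] _] := hN.
by rewrite /conormal !gradX_axis !gradY_axis vec2E0 P1 P2 Q2 !mulr0 add0r addr0.
Qed.

Lemma detXY_axis th : detXY (vec2 th 0) = partial 0 P 0 * partial 1 Q 0.
Proof.
have [_ _ [P1 P2 Q2] _] := hN.
by rewrite /detXY !gradX_axis !gradY_axis P1 mul0r subr0.
Qed.

Lemma detXY_axis_gt0 th : 0 < detXY (vec2 th 0).
Proof. by have [_ _ _ [p0 q0 _]] := hN; rewrite detXY_axis mulr_gt0. Qed.

Lemma g11_axis_gt0 th : 0 < g11 (vec2 th 0).
Proof.
have [_ _ _ [p0 q0 _]] := hN; have [N0 N1 _] := conormal_axis th.
have W := ang_wronskian hA th; rewrite /g11 N0 N1 -!expr2; move: W p0 q0.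
move: (partial 0 P 0) (partial 0 Q 0) (partial 1 Q 0) (n1 th) (n2 th) (dn1 th) (dn2 th).
move=> p r q v1 v2 w1 w2 W p0 q0.
rewrite lt0r addr_ge0 ?sqr_ge0// andbT paddr_eq0 ?sqr_ge0// !sqrf_eq0.
apply/negP => /andP[+ /eqP v2q]; have v20 : v2 = 0.
  by apply/eqP; move/eqP: v2q; rewrite mulf_eq0 (gt_eqF q0) orbF.
rewrite v20 mul0r addr0 mulf_eq0 (gt_eqF p0) orbF => /eqP v10.
by move: W; rewrite v10 v20 !mul0r subrr eqxx.
Qed.

Lemma mu_axis th : mu (vec2 th 0) = 0.
Proof. by rewrite /mu b_axis R0 expr0n mul0r oppr0 mul0r. Qed.

Let V1_axis th : V1 (vec2 th 0). Proof. by have [_ + _] := axis_V1. Qed.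

(** On the axis the surface is tangent to the z-axis because dX and dY have no
    z-component there. *)
Lemma bz_axis th : Dz x (vec2 th 0) = 0 /\ Dz y (vec2 th 0) = 0.
Proof.
have [_ _ [P1 P2 Q2] [p0 q0 _]] := hN.
have := X_derive (E 1) (V1_axis th); have := Y_derive (E 1) (V1_axis th).
rewrite e10 e11 !gradX_axis !gradY_axis P1 P2 Q2 !mulr0 !mul0r !addr0 oppr0 => Y /eqP.
rewrite mulf_eq0 (gt_eqF p0) /= => /eqP X; split=> //; move/eqP: Y.
by rewrite X mulr0 add0r mulf_eq0 (gt_eqF q0) => /eqP.
Qed.

(** On the axis the conormal is the image of (n1, n2) under the constant
    invertible matrix of first derivatives of (P, Q) in (x, y), so its angular
    velocity is the Wronskian times the determinant of that matrix. *)
Lemma II11_axis th : II11 (vec2 th 0) =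
  conormal_inv (vec2 th 0) * (partial 0 P 0 * partial 1 Q 0 * - (n1 th * dn2 th - n2 th * dn1 th)).
Proof.
have [N0 N1 _] := conormal_axis th.
have D0 : Dth (conormal 0) (vec2 th 0) = partial 0 P 0 * dn1 th + partial 0 Q 0 * dn2 th.
  apply: (derive_axis (h := fun t => n1 t * partial 0 P 0 + n2 t * partial 0 Q 0)).
    by move=> t; have [] := conormal_axis t.
  have := ang_n1 hA th; have := ang_n2 hA th => i1 i2.
  by apply: is_derive_eq; rewrite !scaler0 !add0r.
have D1 : Dth (conormal 1) (vec2 th 0) = partial 1 Q 0 * dn2 th.
  apply: (derive_axis (h := fun t => n2 t * partial 1 Q 0)).
    by move=> t; have [] := conormal_axis t.
  have := ang_n2 hA th => i1.
  by apply: is_derive_eq; rewrite !scaler0 !add0r.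
move: D0 D1 N0 N1; rewrite /II11; gen_atoms; subst; ring.
Qed.

(** A decreasing chain of neighbourhoods of the axis, one for each denominator,
    square root or nonzero vector that occurs in the principal data: [V1] is
    where P, Q, R are smooth, [V2] is for mu, [V3] for the frame and the unit
    normal, [V4] for ratio, [V5] and [V6] for the roots, [V7] and [V8] for the
    two direction fields. *)
Definition V2 : set 'rV[K]_2 := [set q | V1 q /\ 0 < detXY q].
Definition V3 : set 'rV[K]_2 := [set q | V2 q /\ 0 < g11 q].
Definition V4 : set 'rV[K]_2 := [set q | V3 q /\ 0 < II11 q ^+ 2].
Definition V5 : set 'rV[K]_2 := [set q | V4 q /\ 0 < lin_coef q].
Definition V6 : set 'rV[K]_2 := [set q | V5 q /\ 0 < disc q].
Definition V7 : set 'rV[K]_2 :=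
  [set q | V6 q /\ 0 < (II11 q - kappa2 q * (mu q * g11 q)) ^+ 2].
Definition V8 : set 'rV[K]_2 :=
  [set q | V7 q /\ 0 < (mu q * II22 q - mu_kappa1 q * g22 q) ^+ 2].

Lemma axis_V2 : axis_nbhd e1 V2.
Proof. exact: axis_nbhd_pos axis_V1 tame_detXY detXY_axis_gt0. Qed.
Let oV2 : open V2. Proof. by case: axis_V2. Qed.
Let V2V1 : V2 `<=` V1. Proof. by move=> q []. Qed.

Let tx2 : tame e1 V2 x. Proof. by apply: tame_sub tx => q [[]]. Qed.
Let ty2 : tame e1 V2 y. Proof. by apply: tame_sub ty => q [[]]. Qed.
Let tn2 j : tame e1 V2 (conormal j). Proof. exact: tame_sub V2V1 (tame_conormal j). Qed.

Lemma tame_g : [/\ tame e1 V2 g11, tame e1 V2 g12 & tame e1 V2 g22].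
Proof.
by have n0 := tn2 0; have n1' := tn2 1; split; rewrite /g11 /g12 /g22; tame_tac.
Qed.

Lemma axis_V3 : axis_nbhd e1 V3.
Proof. by apply: axis_nbhd_pos axis_V2 _ g11_axis_gt0; case: tame_g. Qed.
Let oV3 : open V3. Proof. by case: axis_V3. Qed.
Let V3V2 : V3 `<=` V2. Proof. by move=> q []. Qed.
Let V3V1 : V3 `<=` V1. Proof. by move=> q [[]]. Qed.

Lemma conormal_sq_gt0 q : V3 q -> 0 < conormal_sq q.
Proof. by move=> [_ g0]; rewrite /conormal_sq ltr_pwDl ?sqr_ge0// !expr2. Qed.

Lemma conormal_inv_gt0 q : V3 q -> 0 < conormal_inv q.
Proof. by move=> Vq; rewrite invr_gt0 sqrtr_gt0 conormal_sq_gt0. Qed.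

(** The frame (E1, b_z) is independent because E1 is horizontal and b_z is
    not. *)
Lemma gram_gt0 q : V3 q -> 0 < gram q.
Proof.
move=> [_ g0]; have -> : gram q = g11 q + (conormal 0 q * Dz x q + conormal 1 q * Dz y q) ^+ 2.
  by rewrite /gram /g12 /g22 /g11; gen_atoms; ring.
by rewrite ltr_pwDl ?sqr_ge0.
Qed.

Lemma tame_conormal_inv : tame e1 V3 conormal_inv.
Proof.
have tn j := tame_sub V3V2 (tn2 j).
have n0 := tn 0; have n1' := tn 1; have n2' := tn 2%:R.
apply: tame_inv => // [q /conormal_sq_gt0 n_gt0|]; first by rewrite gt_eqF// sqrtr_gt0.
by apply: tame_sqrt => //; [exact: conormal_sq_gt0|rewrite /conormal_sq; tame_tac].
Qed.

Lemma tame_mu : tame e1 V3 mu.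
Proof.
have [_ _ _ _ tl] := tame_ang; have {}tl := tame_sub V3V1 tl.
have tR := tame_sub V3V1 (tame_coef sR).
have td : tame e1 V3 (fun q => (detXY q)^-1).
  by apply: tame_inv => // [q [[_ /gt_eqF ->]]|] //; exact: tame_sub V3V1 tame_detXY.
by rewrite /mu; tame_tac.
Qed.

Lemma tame_lmk : [/\ tame e1 V3 II11, tame e1 V3 II12 & tame e1 V3 II22].
Proof.
have tn j := tame_sub V3V2 (tn2 j).
have n0 := tn 0; have n1' := tn 1; have n2' := tn 2%:R.
have tc := tame_conormal_inv; have x3 := tame_sub V3V2 tx2; have y3 := tame_sub V3V2 ty2.
by split; rewrite /II11 /II12 /II22; tame_tac.
Qed.

Lemma II11_axis_neq0 th : II11 (vec2 th 0) != 0.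
Proof.
have [_ V3a _] := axis_V3; have [_ _ _ [p0 q0 _]] := hN.
by rewrite II11_axis !mulf_neq0 ?oppr_eq0 ?(ang_wronskian hA)// gt_eqF// conormal_inv_gt0.
Qed.

Lemma axis_V4 : axis_nbhd e1 V4.
Proof.
have [tl _ _] := tame_lmk; apply: axis_nbhd_pos axis_V3 _ _; first exact: tame_exp.
by move=> th; rewrite exprn_even_gt0//= II11_axis_neq0.
Qed.
Let oV4 : open V4. Proof. by case: axis_V4. Qed.
Let V4V3 : V4 `<=` V3. Proof. by move=> q []. Qed.

Lemma II11_neq0 q : V4 q -> II11 q != 0.
Proof. by move=> [_]; rewrite exprn_even_gt0. Qed.

Lemma tame_ratio : tame e1 V4 ratio.
Proof.
have [tl _ _] := tame_lmk; have tm := tame_sub V4V3 tame_mu.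
have ti : tame e1 V4 (fun q => (II11 q)^-1).
  by apply: tame_inv => //; [exact: II11_neq0|exact: tame_sub tl].
by rewrite /ratio; tame_tac.
Qed.

Let V4V2 : V4 `<=` V2. Proof. by move=> q [[]]. Qed.

Lemma tame_V4 : [/\ tame e1 V4 mu, tame e1 V4 II11, tame e1 V4 II12 & tame e1 V4 II22] /\
  [/\ tame e1 V4 g11, tame e1 V4 g12, tame e1 V4 g22 & tame e1 V4 gram].
Proof.
have [tl tm tk] := tame_lmk; have [t11 t12 t22] := tame_g.
have s11 := tame_sub V4V2 t11; have s12 := tame_sub V4V2 t12; have s22 := tame_sub V4V2 t22.
split; split; try by [exact: tame_sub V4V3 _|].
- exact: tame_sub V4V3 tame_mu.
- by rewrite /gram; tame_tac.
Qed.

Lemma tame_BC : tame e1 V4 lin_coef /\ tame e1 V4 cst_coef.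
Proof.
have [[? ? ? ?] [? ? ? ?]] := tame_V4; have ? := tame_ratio.
by split; rewrite /lin_coef /cst_coef; tame_tac.
Qed.

Lemma ratio_axis th : ratio (vec2 th 0) = 0.
Proof. by rewrite /ratio mu_axis mul0r. Qed.

Lemma g22_gt0 q : 0 < g22 q.
Proof. by rewrite /g22 ltr_wpDl// addr_ge0// -expr2 sqr_ge0. Qed.

Lemma lin_coef_axis th : lin_coef (vec2 th 0) = g22 (vec2 th 0).
Proof. by rewrite /lin_coef ratio_axis mul0r addr0. Qed.

Lemma axis_V5 : axis_nbhd e1 V5.
Proof.
have [tB _] := tame_BC; apply: axis_nbhd_pos axis_V4 tB _ => th.
by rewrite lin_coef_axis g22_gt0.
Qed.
Let oV5 : open V5. Proof. by case: axis_V5. Qed.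
Let V5V4 : V5 `<=` V4. Proof. by move=> q []. Qed.

Lemma tame_disc : tame e1 V5 disc.
Proof.
have [tB tC] := tame_BC; have [_ [_ _ _ tD]] := tame_V4; have tT := tame_ratio.
by apply: (tame_sub V5V4); rewrite /disc; tame_tac.
Qed.

Lemma disc_axis th : disc (vec2 th 0) = g22 (vec2 th 0) ^+ 2.
Proof. by rewrite /disc lin_coef_axis ratio_axis !mul0r mulr0 subr0 expr2. Qed.

Lemma axis_V6 : axis_nbhd e1 V6.
Proof.
apply: axis_nbhd_pos axis_V5 tame_disc _ => th.
by rewrite disc_axis exprn_even_gt0//= gt_eqF// g22_gt0.
Qed.
Let oV6 : open V6. Proof. by case: axis_V6. Qed.
Let V6V5 : V6 `<=` V5. Proof. by move=> q []. Qed.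
Let V6V4 : V6 `<=` V4. Proof. by move=> q [[]]. Qed.
Let V6V3 : V6 `<=` V3. Proof. by move=> q [[[]]]. Qed.

Lemma root_disc_gt0 q : V6 q -> 0 < root_disc q.
Proof. by move=> [_ d0]; rewrite sqrtr_gt0. Qed.

Lemma Bs_gt0 q : V6 q -> 0 < lin_coef q + root_disc q.
Proof. by move=> Vq; rewrite addr_gt0 ?root_disc_gt0//; case: Vq => -[]. Qed.

Lemma tame_Bs : tame e1 V6 (fun q => lin_coef q + root_disc q).
Proof.
have [tB _] := tame_BC; have {}tB := tame_sub V6V4 tB.
have ts : tame e1 V6 root_disc.
  by apply: tame_sqrt => //; [move=> q []|exact: tame_sub V6V5 tame_disc].
by tame_tac.
Qed.

Lemma tame_kappa2 : tame e1 V6 kappa2.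
Proof.
have [_ tC] := tame_BC; have {}tC := tame_sub V6V4 tC.
have ti : tame e1 V6 (fun q => (lin_coef q + root_disc q)^-1).
  by apply: tame_inv => //; [move=> q /Bs_gt0 /gt_eqF ->|exact: tame_Bs].
by rewrite /kappa2; tame_tac.
Qed.

Lemma tame_half : tame e1 V6 (fun q => (lin_coef q + root_disc q) / (2 * gram q)).
Proof.
have tB := tame_Bs; have [_ [_ _ _ tD]] := tame_V4; have {}tD := tame_sub V6V4 tD.
have ti : tame e1 V6 (fun q => (2 * gram q)^-1).
  apply: tame_inv => //; last by tame_tac.
  by move=> q /V6V3 Vq; rewrite mulf_neq0 ?pnatr_eq0// gt_eqF// gram_gt0.
by tame_tac.
Qed.

Lemma tame_mu_kappa1 : tame e1 V6 mu_kappa1.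
Proof.
have tH := tame_half; have [[_ tl _ _] _] := tame_V4; have {}tl := tame_sub V6V4 tl.
have -> : mu_kappa1 = (fun q => II11 q * ((lin_coef q + root_disc q) / (2 * gram q))).
  by apply/funext => q; rewrite /mu_kappa1 mulrA.
by tame_tac.
Qed.

Lemma tame_V6 : [/\ tame e1 V6 mu, tame e1 V6 II11, tame e1 V6 II12 & tame e1 V6 II22] /\
  [/\ tame e1 V6 g11, tame e1 V6 g12 & tame e1 V6 g22].
Proof.
by have [[? ? ? ?] [? ? ? ?]] := tame_V4; split; split; exact: tame_sub V6V4 _.
Qed.

Lemma axis_V7 : axis_nbhd e1 V7.
Proof.
have [[? ? ? ?] [? ? ?]] := tame_V6; have ? := tame_kappa2.
apply: axis_nbhd_pos axis_V6 _ _; first by tame_tac.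
by move=> th; rewrite mu_axis mul0r mulr0 subr0 exprn_even_gt0//= II11_axis_neq0.
Qed.
Let V7V6 : V7 `<=` V6. Proof. by move=> q []. Qed.

Lemma axis_V8 : axis_nbhd e1 V8.
Proof.
have [[? ? ? ?] [? ? ?]] := tame_V6; have ? := tame_mu_kappa1; have [_ V7a _] := axis_V7.
apply: axis_nbhd_pos axis_V7 _ _; first by apply: (tame_sub V7V6); tame_tac.
move=> th; have Vq := V7V6 (V7a th); rewrite mu_axis mul0r sub0r exprn_even_gt0//=.
have D0 : gram (vec2 th 0) != 0 by rewrite gt_eqF// gram_gt0//; exact: V6V3.
have B0 : lin_coef (vec2 th 0) + root_disc (vec2 th 0) != 0 by rewrite gt_eqF// Bs_gt0.
have g0 : g22 (vec2 th 0) != 0 by rewrite gt_eqF// g22_gt0.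
rewrite oppr_eq0; apply: mulf_neq0 => //; apply: mulf_neq0.
  by apply: mulf_neq0 => //; exact: II11_axis_neq0.
by rewrite invr_eq0; apply: mulf_neq0 => //; rewrite pnatr_eq0.
Qed.
Let V8V6 : V8 `<=` V6. Proof. by move=> q [[]]. Qed.

Opaque conormal gradX gradY.

Hypothesis hnu : forall q, nu_tilde e1 e2 P Q R b q =
  n1 (q 0 0) *: grad (Xfun e1 e2 P R (q 0 0)) (b q) +
  n2 (q 0 0) *: grad (Yfun e1 e2 Q R (q 0 0)) (b q).

Notation n := (nu e1 e2 P Q R b).

Lemma nu_entry q j : V1 q -> n q 0 j = conormal_inv q * conormal j q.
Proof.
move=> Vq; have entryE i : nu_tilde e1 e2 P Q R b q 0 i = conormal i q.
  by rewrite hnu !mxE -gradXE// -gradYE.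
have sqE : dot (nu_tilde e1 e2 P Q R b q) (nu_tilde e1 e2 P Q R b q) = conormal_sq q.
  by rewrite /dot sum_ord3 !entryE.
by rewrite /nu mxE entryE /enorm sqE.
Qed.

Opaque nu bmap jacobian.

Let near_V1 q : V3 q -> \forall p \near q, V1 p.
Proof. by move=> /V3V1 Vq; exact: open_nbhs_nbhs. Qed.

Let dct q : V3 q -> differentiable conormal_inv q.
Proof. by move=> Vq; exact: smooth_on_diff tame_conormal_inv.1 Vq. Qed.

Let dnt j q : V3 q -> differentiable (conormal j) q.
Proof. by move=> /V3V1 Vq; exact: smooth_on_diff (tame_conormal j).1 Vq. Qed.

Lemma nu_jacobian q i j : V3 q ->
  ('J n q) i j = 'D_(E i) conormal_inv q * conormal j q + conormal_inv q * 'D_(E i) (conormal j) q.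
Proof.
move=> Vq; have nE k : \forall p \near q, conormal_inv p * conormal k p = n p 0 k.
  by apply: filterS (near_V1 Vq) => p Vp; rewrite nu_entry.
have dn k : differentiable (fun p => n p 0 k) q.
  by apply: near_eq_differentiable (nE k) _; apply: differentiableM; [exact: dct|exact: dnt].
rewrite jacobianE// -derive_mul; [|exact: dct|exact: dnt].
exact/esym/near_eq_derive/nE.
Qed.

Lemma b_jacobian q i : V1 q ->
  [/\ ('J b q) i 0 = 'D_(E i) x q, ('J b q) i 1 = 'D_(E i) y q & ('J b q) i 2%:R = E i 0 1].
Proof. by move=> Vq; rewrite !jacobianE ?b0 ?b1 ?b2 ?derive_coord//; exact: db. Qed.

(** Differentiating the factor 1 / |nu| only produces multiples of the conormal,
    which are orthogonal to the tangent vectors. *)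
Lemma second_formE q i k : V3 q -> second_form b n q i k =
  - (conormal_inv q * ('D_(E i) (conormal 0) q * 'D_(E k) x q
      + 'D_(E i) (conormal 1) q * 'D_(E k) y q
      + 'D_(E i) (conormal 2%:R) q * E k 0 1)).
Proof.
move=> Vq; have [J0 J1 J2] := b_jacobian k (V3V1 Vq).
have T := conormal_tangent (E k) (V3V1 Vq).
have N0 := nu_jacobian i 0 Vq; have N1 := nu_jacobian i 1 Vq.
have N2 := nu_jacobian i 2%:R Vq; rewrite [LHS]mxE mulmx_tr3; congr (- _).
move: J0 J1 J2 N0 N1 N2; move: ('J n q) ('J b q) => A B -> -> -> -> -> ->.
transitivity ('D_(E i) conormal_inv q *
    (conormal 0 q * 'D_(E k) x q + conormal 1 q * 'D_(E k) y q + conormal 2%:R q * E k 0 1)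
  + conormal_inv q * ('D_(E i) (conormal 0) q * 'D_(E k) x q
      + 'D_(E i) (conormal 1) q * 'D_(E k) y q
      + 'D_(E i) (conormal 2%:R) q * E k 0 1)); first by gen_atoms; ring.
by rewrite T mulr0 add0r.
Qed.

Lemma conormal_derive q v w : V3 q ->
  'D_w (conormal 0) q * 'D_v x q + 'D_w (conormal 1) q * 'D_v y q + 'D_w (conormal 2%:R) q * v 0 1 =
  - (conormal 0 q * 'D_w ('D_v x) q + conormal 1 q * 'D_w ('D_v y) q).
Proof.
move=> Vq; have Uq := V1U (V3V1 Vq).
have dx : differentiable ('D_v x) q by apply: smooth_on_diff Uq; exact/smooth_on_derive/tx.1.
have dy : differentiable ('D_v y) q by apply: smooth_on_diff Uq; exact/smooth_on_derive/ty.1.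
have zero : \forall p \near q,
    conormal 0 p * 'D_v x p + conormal 1 p * 'D_v y p + conormal 2%:R p * v 0 1 = 0.
  by apply: filterS (near_V1 Vq) => p Vp; exact: conormal_tangent.
exact: derive_relation (dnt 0 Vq) (dnt 1 Vq) (dnt 2%:R Vq) dx dy zero.
Qed.

(** The entry (1, 0) is the derivative of the normal in z paired with
    b_theta = mu E1, hence divisible by mu; the entry (0, 1) is equal to it
    because b_{theta z} = b_{z theta}. *)
Lemma second_form_entries q : V3 q ->
  [/\ second_form b n q 0 0 = mu q * II11 q, second_form b n q 0 1 = mu q * II12 q,
      second_form b n q 1 0 = mu q * II12 q & second_form b n q 1 1 = II22 q].
Proof.
move=> Vq; have d0 : detXY q != 0 by rewrite gt_eqF//; case: Vq => -[].
have [bx by'] := b_theta (V3V1 Vq) d0.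
have II10 : second_form b n q 1 0 = mu q * II12 q.
  rewrite (second_formE 1 0 Vq) e01 /II12; move: bx by'; gen_atoms; subst; ring.
split; [| |exact: II10|].
- rewrite (second_formE 0 0 Vq) e01 /II11; move: bx by'; gen_atoms; subst; ring.
- rewrite -II10 (second_formE 0 1 Vq) (second_formE 1 0 Vq) !(conormal_derive _ _ Vq).
  have cx := derive_comm (E 0) (E 1) oU (V1U (V3V1 Vq)) tx.1.
  have cy := derive_comm (E 0) (E 1) oU (V1U (V3V1 Vq)) ty.1.
  by move: cx cy; gen_atoms; subst.
- rewrite (second_formE 1 1 Vq) e11 /II22; gen_atoms; ring.
Qed.

Lemma first_form_entries q : V3 q ->
  [/\ first_form b q 0 0 = mu q * mu q * g11 q, first_form b q 0 1 = mu q * g12 q,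
      first_form b q 1 0 = mu q * g12 q & first_form b q 1 1 = g22 q].
Proof.
move=> Vq; have d0 : detXY q != 0 by rewrite gt_eqF//; case: Vq => -[].
have [bx by'] := b_theta (V3V1 Vq) d0.
have [J00 J01 J02] := b_jacobian 0 (V3V1 Vq); have [J10 J11 J12] := b_jacobian 1 (V3V1 Vq).
have FE i k := mulmx_tr3 ('J b q) ('J b q) i k.
move: FE J00 J01 J02 J10 J11 J12; rewrite /first_form; move: ('J b q) => B FE.
move=> J00 J01 J02 J10 J11 J12.
rewrite !FE /g11 /g12 /g22 J00 J01 J02 J10 J11 J12 e01 e11.
by move: bx by'; gen_atoms; subst; split; ring.
Qed.

Lemma mu_regular q : V3 q -> regular_point b q <-> mu q != 0.
Proof.
move=> Vq; have d0 : detXY q != 0 by rewrite gt_eqF//; case: Vq => -[].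
have [bx by'] := b_theta (V3V1 Vq) d0; have [J00 J01 J02] := b_jacobian 0 (V3V1 Vq).
split=> [/row_freeP[B JB]|mu0].
- apply/eqP => mu0; have := congr1 (fun M : 'M[K]_2 => M 0 0) JB.
  rewrite !mxE sum_ord3; move: J00 J01 J02; move: ('J b q) => J -> -> ->.
  rewrite bx by' e01 mu0 !mul0r oppr0 !mul0r !addr0 => /eqP.
  by rewrite eq_sym oner_eq0.
- have [I00 I01 I10 I11] := first_form_entries Vq.
  have [A00 A01 A10 A11] := second_form_entries Vq.
  have [_ uI _ _ _] := shape_mx A00 A01 A10 A11 I00 I01 I10 I11 mu0 (lt0r_neq0 (gram_gt0 Vq)).
  apply/row_freeP; exists (('J b q)^T *m invmx (first_form b q)).
  by rewrite mulmxA mulmxV.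
Qed.

Lemma root_disc_sqr q : V8 q ->
  root_disc q * root_disc q = lin_coef q * lin_coef q - 4 * (ratio q * gram q * cst_coef q).
Proof. by move=> /V8V6[_ d0]; rewrite -expr2 sqr_sqrtr// ltW. Qed.

Lemma mu_kappa1E q : V8 q -> mu q != 0 -> mu_kappa1 q = mu q * kappa1 q.
Proof.
move=> Vq mu0; have l0 := II11_neq0 (V6V4 (V8V6 Vq)).
have D0 := lt0r_neq0 (gram_gt0 (V6V3 (V8V6 Vq))).
rewrite /mu_kappa1 /kappa1 /ratio; move: mu0 l0 D0.
move: (mu q) (II11 q) (gram q) (lin_coef q + root_disc q) => a l d c.
by move=> a0 l0 d0; field; rewrite a0 l0 d0.
Qed.

Lemma principal q : V8 q -> regular_point b q ->
  [/\ principal_curvatures b n q (kappa1 q) (kappa2 q),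
      (<<direction1 q>> == eigenspace (shape_operator b n q) (kappa1 q))%MS &
      (<<direction2 q>> == eigenspace (shape_operator b n q) (kappa2 q))%MS].
Proof.
move=> Vq; have V6q := V8V6 Vq; have V3q := V6V3 V6q => /(mu_regular V3q) mu0.
have l0 := II11_neq0 (V6V4 V6q); have D0 := lt0r_neq0 (gram_gt0 V3q).
have Bs0 := lt0r_neq0 (Bs_gt0 V6q).
have [A00 A01 A10 A11] := second_form_entries V3q.
have [B00 B01 B10 B11] := first_form_entries V3q.
have [SB uB S00 S11 Sdet] := shape_mx A00 A01 A10 A11 B00 B01 B10 B11 mu0 D0.
have two0 : 2 != 0 :> K by rewrite pnatr_eq0.
have [sum prod diff quad] := principal_values l0 mu0 D0 Bs0 two0 (root_disc_sqr Vq).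
rewrite -/(gram q) -/(ratio q) -/(lin_coef q) -/(cst_coef q) in sum prod diff quad.
rewrite -/(kappa1 q) -/(kappa2 q) in sum prod diff quad.
rewrite -/(shape_operator b n q) in SB S00 S11 Sdet.
have tr : kappa1 q + kappa2 q = shape_operator b n q 0 0 + shape_operator b n q 1 1.
  by rewrite S00 S11; exact: sum.
have tr' : kappa2 q + kappa1 q = shape_operator b n q 0 0 + shape_operator b n q 1 1.
  by rewrite -tr; exact: addrC.
have dt' : kappa1 q * kappa2 q = shape_operator b n q 0 0 * shape_operator b n q 1 1
    - shape_operator b n q 0 1 * shape_operator b n q 1 0.
  by rewrite Sdet; exact: prod.
have k12 : kappa1 q != kappa2 q.
  have t0 : ratio q != 0 by apply: mulf_neq0; rewrite ?invr_eq0.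
  rewrite -subr_eq0 diff; apply: mulf_neq0; first exact: lt0r_neq0 (root_disc_gt0 V6q).
  by rewrite invr_eq0; apply: mulf_neq0.
have [_ _ c1 c2] := pencil_kernel (quad _ (or_introl erefl)).
have [c3 c4 _ _] := pencil_kernel (quad _ (or_intror erefl)).
rewrite -(mu_kappa1E Vq mu0) in c1 c2.
split.
- exact: char_poly2 tr dt'.
- apply: eigenspace_line tr k12 _ _.
    apply/eqP => /rowP /(_ 0); rewrite [RHS]mxE vec2E0 => xi0.
    by case: Vq => _; rewrite xi0 expr0n ltxx.
  apply: eigen_of_pencil SB uB _ _; rewrite vec2E0 vec2E1.
    by rewrite A00 A10 B00 B10 mulNr; exact: c1.
  by rewrite A01 A11 B01 B11 mulNr; exact: c2.
- apply: (eigenspace_line tr') => //; first by rewrite eq_sym.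
    apply/eqP => /rowP /(_ 1); rewrite [RHS]mxE vec2E1 => xi0.
    by case: Vq => -[_]; rewrite xi0 expr0n ltxx.
  apply: eigen_of_pencil SB uB _ _; rewrite vec2E0 vec2E1.
    by rewrite A00 A10 B00 B10; exact: c3.
  by rewrite A01 A11 B01 B11; exact: c4.
Qed.

Lemma smooth_direction_line (xi : 'rV[K]_2 -> 'rV[K]_2) : tame e1 V8 (fun q => xi q 0 0) ->
  tame e1 V8 (fun q => xi q 0 1) -> (forall q, V8 q -> xi q != 0) ->
  smooth_direction_field e1 V8 (fun q => <<xi q>>%MS).
Proof.
move=> t0 t1 xi0; have [oV8 _ _] := axis_V8; split=> [p Vp|e1N q Vq].
  exists V8, xi; split=> //; last by move=> q Vq; rewrite xi0//; split=> //; apply/eqmxP/genmxE.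
  by apply: smooth_on_row => // j; have [->|->] := ord2E j; [exact: t0.1|exact: t1.1].
have -> : xi (turn q) = xi q by apply/rowP => j; have [->|->] := ord2E j; [exact: t0.2|exact: t1.2].
exact/eqmxP/eqmx_refl.
Qed.

(** On the axis b_z = (0, 0, 1). *)
Lemma R_nonflat th : Dz (fun q => R (b q)) (vec2 th 0) = partial 2%:R R 0.
Proof.
have Vq := V1_axis th; have [x0 y0] := bz_axis th.
have [_ ->] := derive_comp (E 1) (db Vq) (dR Vq).
by rewrite sum_ord3 b0 b1 b2 derive_coord x0 y0 b_axis e11 !mulr0 !add0r mulr1.
Qed.

(** Near a point of the axis where la <> 0, kappa1 is psi / ratio with psi > 0
    on the axis and ratio = 0 there.  Points off the axis with ratio <> 0 exist
    in every neighbourhood: otherwise R along b would vanish near that point,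
    against [R_nonflat]. *)
Lemma kappa1_unbounded W M : axis_nbhd e1 W ->
  exists q, [/\ V8 q, W q, regular_point b q & M < `|kappa1 q|].
Proof.
move=> [oW Wa _]; have [th la0] := ang_nonzero hA.
have [oV8 V8a _] := axis_V8; have V6a th' := V8V6 (V8a th').
pose psi q := (lin_coef q + root_disc q) / (2 * gram q).
(* Positivity of small means M * |ratio| < psi, in a form that is smooth. *)
pose small q := psi q ^+ 2 - (M * ratio q) ^+ 2.
have psi_gt0 q : V6 q -> 0 < psi q.
  by move=> Vq; rewrite divr_gt0 ?Bs_gt0// mulr_gt0// gram_gt0//; exact: V6V3.
have tsmall : tame e1 V6 small.
  have th' : tame e1 V6 psi := tame_half; have tT := tame_sub V6V4 tame_ratio.
  by rewrite /small; tame_tac.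
have small_a th' : 0 < small (vec2 th' 0).
  by rewrite /small ratio_axis mulr0 expr0n subr0 exprn_even_gt0//= lt0r_neq0// psi_gt0.
have [oS Sa _] := axis_nbhd_pos axis_V6 tsmall small_a.
have tla : tame e1 V1 (fun q => la (q 0 0)) by have [] := tame_ang.
have la_near : \forall q \near vec2 th 0, la ((q : 'rV[K]_2) 0 0) != 0.
  have c : {for vec2 th 0, continuous (fun q : 'rV[K]_2 => la (q 0 0))}.
    exact/differentiable_continuous/(smooth_on_diff tla.1)/V1_axis.
  by apply: cvgr_neq0 c _; rewrite vec2E0.
have [q [Vq Wq Sq laq Rq]] : exists q, [/\ V8 q, W q, 0 < small q, la (q 0 0) != 0 & R (b q) != 0].
  apply: contrapT => none.
  have flat : \forall q \near vec2 th 0, R (b q) = cst 0 q.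
    have nV := open_nbhs_nbhs (conj oV8 (V8a th)).
    have nW := open_nbhs_nbhs (conj oW (Wa th)).
    have nS := open_nbhs_nbhs (conj oS (Sa th)).
    near=> q; apply/eqP; apply: contrapT => /negP Rq; apply: none; exists q; split.
    - by near: q.
    - by near: q.
    - by have [] : V6 q /\ 0 < small q by near: q.
    - by near: q.
    - exact: Rq.
  have := R_nonflat th; rewrite (near_eq_derive _ flat) derive_cst => /esym R0'.
  by have [_ _ _ [_ _]] := hN; rewrite R0' ltxx.
have V6q := V8V6 Vq; have V3q := V6V3 V6q.
have d0 : detXY q != 0 by rewrite gt_eqF//; case: V3q => -[].
have mu0 : mu q != 0.
  by rewrite /mu mulf_neq0 ?invr_eq0// oppr_eq0 mulf_neq0// expf_neq0.
have t0 : ratio q != 0 by rewrite mulf_neq0 ?invr_eq0// II11_neq0//; exact: V6V4.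
exists q; split=> //; first exact/mu_regular.
have kE : kappa1 q = psi q / ratio q.
  have D0 := lt0r_neq0 (gram_gt0 V3q); rewrite /kappa1 /psi; move: t0 D0.
  move: (ratio q) (gram q) (lin_coef q + root_disc q) => t d c t0 d0'.
  by field; rewrite t0 d0'.
apply: le_lt_trans (ler_norm M) _; rewrite kE normf_div ltr_pdivlMr ?normr_gt0//.
rewrite -normrM -ltr_sqr ?nnegrE// !real_normK ?num_real//.
by rewrite -subr_gt0.
Unshelve. all: by end_near. Qed.

Theorem principal_data :
  exists (V : set 'rV[K]_2) (k1 k2 : 'rV[K]_2 -> K) (D1 D2 : 'rV[K]_2 -> 'M[K]_2),
    [/\ axis_nbhd e1 V /\ V `<=` U,
        periodic_on e1 V k1 /\ periodic_on e1 V k2,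
        forall q, V q -> regular_point b q ->
          principal_curvatures b n q (k1 q) (k2 q),
        smooth_on V k2 &
        forall W : set 'rV[K]_2, axis_nbhd e1 W ->
          forall M : K, exists q,
            [/\ V q, W q, regular_point b q & M < `|k1 q|]] /\
    [/\ smooth_direction_field e1 V D1, smooth_direction_field e1 V D2 &
        forall q, V q -> regular_point b q ->
          (D1 q == eigenspace (shape_operator b n q) (k1 q))%MS /\
          (D2 q == eigenspace (shape_operator b n q) (k2 q))%MS].
Proof.
have tk2 := tame_sub V8V6 tame_kappa2.
exists V8, kappa1, kappa2, (fun q => <<direction1 q>>%MS), (fun q => <<direction2 q>>%MS).
have [[tmu tl tm tk] [t11 t12 t22]] := tame_V6; have tK := tame_mu_kappa1; have tk2' := tame_kappa2.
split; split.
- by split; [exact: axis_V8|move=> q /V8V6 /V6V3 /V3V1 /V1U].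
- split; last exact: tk2.2.
  move=> e1N q /V8V6 Vq; have V4q := V6V4 Vq.
  have [_ [_ _ _ tD]] := tame_V4.
  by rewrite /kappa1 (tame_Bs.2 e1N q Vq) (tame_ratio.2 e1N q V4q) (tD.2 e1N q V4q).
- by move=> q Vq rq; have [] := principal Vq rq.
- exact: tk2.1.
- by move=> W hW M; exact: kappa1_unbounded.
- apply: smooth_direction_line.
  + under eq_fun do rewrite vec2E0; apply: (tame_sub V8V6); tame_tac.
  + under eq_fun do rewrite vec2E1; apply: (tame_sub V8V6); tame_tac.
  + move=> q Vq; apply/eqP => /rowP /(_ 0); rewrite [RHS]mxE vec2E0 => xi0.
    by case: Vq => _; rewrite xi0 expr0n ltxx.
- apply: smooth_direction_line.
  + under eq_fun do rewrite vec2E0; apply: (tame_sub V8V6); tame_tac.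
  + under eq_fun do rewrite vec2E1; apply: (tame_sub V8V6); tame_tac.
  + move=> q Vq; apply/eqP => /rowP /(_ 1); rewrite [RHS]mxE vec2E1 => xi0.
    by case: Vq => -[_]; rewrite xi0 expr0n ltxx.
- by move=> q Vq rq; have [] := principal Vq rq.
Qed.

End Surface.

(** * Circular and hyperbolic angles *)

Section Angles.
Context {K : realType}.
Implicit Types (f g : K -> K) (t : K).

Lemma is_derive_mul f g t (a b : K) : is_derive t 1 f a -> is_derive t 1 g b ->
  is_derive t 1 (fun u => f u * g u) (a * g t + f t * b).
Proof.
move=> df dg; have := is_deriveM df dg; rewrite addrC -[g t *: a]/(g t * a) [g t * a]mulrC.
exact.
Qed.

Lemma is_derive_lin f g t (k l a b : K) : is_derive t 1 f a -> is_derive t 1 g b ->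
  is_derive t 1 (fun u => k * f u + l * g u) (k * a + l * b).
Proof. by move=> df dg; apply: is_deriveD. Qed.

Lemma tame_lift (e1 : K) (H : nat -> K -> K) i :
  (forall i (t : K), is_derive t 1 (H i) (H i.+1 t)) ->
  (e1 = -1 -> forall t, H i (t + 2 * pi) = H i t) ->
  tame e1 setT (fun q : 'rV[K]_2 => H i (q 0 0)).
Proof.
move=> dH pH; split=> [|e1N q _].
  apply: smooth_exprP; first exact: openT.
  by apply: se_post dH _; apply: se_base; exact: smooth_on_coord.
by rewrite /turn mxE vec2E0 pH.
Qed.

Variables (e1 : K) (c s : K -> K).
Hypothesis he1 : e1 = 1 \/ e1 = -1.
Hypothesis dc : forall t, is_derive t 1 c (e1 * s t).
Hypothesis ds : forall t, is_derive t 1 s (c t).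
Hypothesis cs : forall t, c t * c t = 1 + e1 * (s t * s t).
Hypothesis tc : tame e1 setT (fun q => c (q 0 0)).
Hypothesis ts : tame e1 setT (fun q => s (q 0 0)).

Let C t := c t * c t + e1 * (s t * s t).
Let S t := 2 * (s t * c t).

(** With (c, s) = (cos, sin) or (cosh, sinh), C and S are the values at the double
    angle, and these are alpha and beta. *)
Definition gen_alpha e2 t : K := (C t * C t + e1 * (S t * S t)) / 2 + e2 * C t.
Definition gen_beta e2 t : K := e1 * (C t * S t - e2 * S t).

Let dC t : is_derive t 1 C (2 * e1 * S t).
Proof.
have := is_derive_lin 1 e1 (is_derive_mul (dc t) (dc t)) (is_derive_mul (ds t) (ds t)).
rewrite (_ : (fun _ => _) = C); last by apply/funext => u; rewrite /C mul1r.
by move=> D; apply: is_derive_eq; rewrite /S; ring.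
Qed.

Let dS t : is_derive t 1 S (2 * C t).
Proof.
have := is_derive_lin 2 0 (is_derive_mul (ds t) (dc t)) (ds t).
rewrite (_ : (fun _ => _) = S); last by apply/funext => u; rewrite /S mul0r addr0.
by move=> D; apply: is_derive_eq; rewrite /C; ring.
Qed.

Lemma gen_alpha_derive e2 t : is_derive t 1 (gen_alpha e2) (2 * e1 * S t * (2 * C t + e2)).
Proof.
have D := is_derive_lin 1 e1 (is_derive_mul (dC t) (dC t)) (is_derive_mul (dS t) (dS t)).
have := is_derive_lin 2^-1 e2 D (dC t).
rewrite (_ : (fun _ => _) = gen_alpha e2); last first.
  by apply/funext => u; rewrite /gen_alpha mul1r mulrC.
by move=> {}D; apply: is_derive_eq; field.
Qed.

Lemma gen_beta_derive e2 t :
  is_derive t 1 (gen_beta e2) (2 * e1 * (e1 * (S t * S t) + C t * C t - e2 * C t)).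
Proof.
have := is_derive_lin e1 (- (e1 * e2)) (is_derive_mul (dC t) (dS t)) (dS t).
rewrite (_ : (fun _ => _) = gen_beta e2); last first.
  by apply/funext => u; rewrite /gen_beta; ring.
by move=> D; apply: is_derive_eq; ring.
Qed.

Lemma gen_tame e2 : tame e1 setT (fun q => gen_alpha e2 (q 0 0)) /\
  tame e1 setT (fun q => gen_beta e2 (q 0 0)).
Proof.
have oT : open [set: 'rV[K]_2] := openT.
by split; rewrite /gen_alpha /gen_beta /C /S; tame_tac.
Qed.

(** By the double angle formulas both derivatives have the factor
    s (3 + 4 e1 s^2), which is s at the triple angle. *)
Lemma angular_plus : (exists t, s t != 0 /\ 3 + 4 * e1 * s t ^+ 2 != 0) ->
  angular e1 (gen_alpha 1) (gen_beta 1) s (fun t => - (e1 * c t))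
    (fun t => 4 * (s t * (3 + 4 * e1 * s t ^+ 2))) c (fun t => - s t).
Proof.
move=> [t0 [s0 p0]]; have oT : open [set: 'rV[K]_2] := openT.
have [ta tb] := gen_tame 1; split => [|t|t|t|t|t|].
- by split=> //; tame_tac.
- apply: (is_derive_eq (gen_alpha_derive 1 t)); rewrite /S /C cs.
  by case: he1 => ->; ring.
- apply: (is_derive_eq (gen_beta_derive 1 t)).
  have -> : S t * S t = 4 * (s t * s t * (c t * c t)) by rewrite /S; ring.
  by rewrite /C cs; case: he1 => ->; ring.
- exact: ds.
- have := is_derive_lin (- e1) 0 (dc t) (dc t).
  rewrite (_ : (fun _ => _) = (fun t => - (e1 * c t))); last by apply/funext => u; ring.
  by move=> D; apply: is_derive_eq; case: he1 => ->; ring.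
- have -> : s t * - s t - - (e1 * c t) * c t = e1 * (c t * c t) - s t * s t by ring.
  have -> : e1 * (c t * c t) - s t * s t = e1 by rewrite cs; case: he1 => ->; ring.
  by case: he1 => ->; rewrite ?oppr_eq0 oner_eq0.
- by exists t0; rewrite !mulf_neq0 ?pnatr_eq0.
Qed.

(** As for [angular_plus], with the factor c (4 c^2 - 3), which is c at the
    triple angle. *)
Lemma angular_minus : (exists t, c t = 1) ->
  angular e1 (gen_alpha (-1)) (gen_beta (-1)) c (fun t => - s t)
    (fun t => 4 * e1 * (c t * (4 * c t ^+ 2 - 3))) (fun t => e1 * s t) (fun t => - c t).
Proof.
move=> [t0 c0]; have oT : open [set: 'rV[K]_2] := openT.
have [ta tb] := gen_tame (-1).
have ss t : e1 * (s t * s t) = c t * c t - 1 by rewrite cs addrC addKr.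
split => [|t|t|t|t|t|].
- by split=> //; tame_tac.
- apply: (is_derive_eq (gen_alpha_derive (-1) t)); rewrite /S /C ss; ring.
- apply: (is_derive_eq (gen_beta_derive (-1) t)).
  have -> : e1 * (S t * S t) = 4 * (e1 * (s t * s t)) * (c t * c t) by rewrite /S; ring.
  by rewrite /C ss; ring.
- exact: dc.
- have := is_derive_lin (- 1) 0 (ds t) (ds t).
  rewrite (_ : (fun _ => _) = (fun t => - s t)); last by apply/funext => u; ring.
  by move=> D; apply: is_derive_eq; ring.
- have -> : c t * - c t - - s t * (e1 * s t) = e1 * (s t * s t) - c t * c t by ring.
  by rewrite ss addrAC subrr sub0r oppr_eq0 oner_eq0.
- exists t0; rewrite c0 expr1n mul1r mulr1 mulf_neq0 ?mulf_neq0 ?pnatr_eq0//.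
  by case: he1 => ->; rewrite ?oppr_eq0 oner_eq0.
Qed.

End Angles.

Section Instances.
Context {K : realType}.
Implicit Types t : K.

Let cos_mul2 t : cos (2 * t) = cos t * cos t + -1 * (sin t * sin t).
Proof. by rewrite mulr_natl mulr2n cosD mulN1r. Qed.

Let sin_mul2 t : sin (2 * t) = 2 * (sin t * cos t).
Proof. by rewrite mulr_natl mulr2n sinD [cos t * _]mulrC -mulr2n mulr_natl. Qed.

Let cosh_mul2 t : cosh (2 * t) = cosh t * cosh t + 1 * (sinh t * sinh t).
Proof. by rewrite /cosh /sinh mulr_natl mulr2n opprD !expRD; field. Qed.

Let sinh_mul2 t : sinh (2 * t) = 2 * (sinh t * cosh t).
Proof. by rewrite /cosh /sinh mulr_natl mulr2n opprD !expRD; field. Qed.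

Lemma alpha_circ e2 : alpha (-1) e2 = gen_alpha (-1) (@cos K) sin e2.
Proof.
by apply/funext => t; rewrite /alpha eqxx cos_mul2 sin_mul2 /gen_alpha; field.
Qed.

Lemma beta_circ e2 : beta (-1) e2 = gen_beta (-1) (@cos K) sin e2.
Proof.
by apply/funext => t; rewrite /beta eqxx cos_mul2 sin_mul2 /gen_beta; ring.
Qed.

Let oneN1 : (1 == -1 :> K) = false.
Proof. by rewrite gt_eqF// gtrN. Qed.

Lemma alpha_hyp e2 : alpha 1 e2 = gen_alpha 1 (@cosh K) sinh e2.
Proof.
by apply/funext => t; rewrite /alpha oneN1 cosh_mul2 sinh_mul2 /gen_alpha; field.
Qed.

Lemma beta_hyp e2 : beta 1 e2 = gen_beta 1 (@cosh K) sinh e2.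
Proof.
by apply/funext => t; rewrite /beta oneN1 cosh_mul2 sinh_mul2 /gen_beta; ring.
Qed.

Let expRN_derive t : is_derive t 1 (fun u : K => expR (- u)) (- expR (- t)).
Proof.
have := is_derive1_comp (is_derive_expR (- t)) (is_deriveNid t 1).
by rewrite mulrN1.
Qed.

Lemma cosh_derive t : is_derive t 1 (@cosh K) (sinh t).
Proof.
have := is_derive_lin 2^-1 2^-1 (is_derive_expR t) (expRN_derive t).
rewrite (_ : (fun _ => _) = cosh); last by apply/funext => u; rewrite /cosh; ring.
by move=> D; apply: is_derive_eq; rewrite /sinh; ring.
Qed.

Lemma sinh_derive t : is_derive t 1 (@sinh K) (cosh t).
Proof.
have := is_derive_lin 2^-1 (- 2^-1) (is_derive_expR t) (expRN_derive t).
rewrite (_ : (fun _ => _) = sinh); last by apply/funext => u; rewrite /sinh; ring.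
by move=> D; apply: is_derive_eq; rewrite /cosh; ring.
Qed.

Lemma cosh_sqr t : cosh t * cosh t = 1 + 1 * (sinh t * sinh t).
Proof.
transitivity (expR t * expR (- t) + 1 * (sinh t * sinh t)).
  by rewrite /cosh /sinh; field.
by rewrite expRxMexpNx_1.
Qed.

Lemma tame_hyp : tame 1 setT (fun q : 'rV[K]_2 => cosh (q 0 0)) /\
  tame 1 setT (fun q : 'rV[K]_2 => sinh (q 0 0)).
Proof.
pose H i : K -> K := if odd i then sinh else cosh.
have dH i t : is_derive t 1 (H i) (H i.+1 t).
  by rewrite /H /=; case: (odd i); [exact: sinh_derive|exact: cosh_derive].
have np (i : nat) : (1 : K) = -1 -> forall t, H i (t + 2 * pi) = H i t.
  by move/eqP; rewrite oneN1.
by split; [exact: (tame_lift dH (np 0%N))|exact: (tame_lift dH (np 1%N))].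
Qed.

Lemma tame_circ : tame (-1) setT (fun q : 'rV[K]_2 => cos (q 0 0)) /\
  tame (-1) setT (fun q : 'rV[K]_2 => sin (q 0 0)).
Proof.
(* Both functions and all their derivatives are translates of the sine. *)
pose H i t : K := sin (t + (pi / 2) *+ i).
have dH i t : is_derive t 1 (H i) (H i.+1 t).
  have := @is_derive1_comp _ sin (shift ((pi / 2) *+ i)) t _ _
    (is_derive_sin (t + (pi / 2) *+ i)) (is_derive_shift t 1 ((pi / 2) *+ i)).
  by rewrite mulr1 /H [_ *+ i.+1]mulrSr addrA sinDpihalf.
have pH i : -1 = -1 :> K -> forall t, H i (t + 2 * pi) = H i t.
  by move=> _ t; rewrite /H addrAC [2 * pi]mulr_natl sinD2pi.
have H1 : H 1%N = cos by apply/funext => t; rewrite /H mulr1n sinDpihalf.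
have H0 : H 0%N = sin by apply/funext => t; rewrite /H mulr0n addr0.
by rewrite -H1 -H0; split; [exact: (tame_lift dH (pH 1%N))|exact: (tame_lift dH (pH 0%N))].
Qed.

End Instances.

Lemma normal_coefs_domain (K : realType) (P Q R : 'rV[K]_3 -> K) : normal_coefs P Q R ->
  exists O : set 'rV[K]_3, [/\ open_nbhs (0 : 'rV[K]_3) O,
    smooth_on O P, smooth_on O Q & smooth_on O R].
Proof.
move=> [[[OP nP sP] [OQ nQ sQ] [OR nR sR]] _ _ _]; exists (OP `&` (OQ `&` OR)); split.
- by do 2?apply: open_nbhsI.
- by apply: smooth_on_sub sP => p [].
- by apply: smooth_on_sub sQ => p [_ []].
- by apply: smooth_on_sub sR => p [_ []].
Qed.

Lemma angular_normal (K : realType) (e1 e2 : K) : e1 = 1 \/ e1 = -1 -> e2 = 1 \/ e2 = -1 ->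
  exists n1 n2 la dn1 dn2 : K -> K,
    angular e1 (alpha e1 e2) (beta e1 e2) n1 n2 la dn1 dn2 /\
    forall P Q R b q, nu_tilde e1 e2 P Q R b q =
      n1 (q 0 0) *: grad (Xfun e1 e2 P R (q 0 0)) (b q) +
      n2 (q 0 0) *: grad (Yfun e1 e2 Q R (q 0 0)) (b q).
Proof.
have oneN1 : (1 == -1 :> K) = false by rewrite gt_eqF// gtrN.
move=> he1 he2; case: (he1) => e1E; subst e1; case: he2 => e2E; subst e2.
- do 5!eexists; split.
    rewrite alpha_hyp beta_hyp; apply: angular_plus => //.
    + by move=> t; rewrite mul1r; exact: cosh_derive.
    + exact: sinh_derive.
    + exact: cosh_sqr.
    + exact: tame_hyp.1.
    + exact: tame_hyp.2.
    + exists 1; split; last by rewrite gt_eqF// ltr_pwDl// mulr1 mulr_ge0// sqr_ge0.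
      by rewrite /sinh mulf_neq0 ?invr_eq0 ?pnatr_eq0// subr_eq0 gt_eqF// ltr_expR gtrN.
  by move=> P Q R b q; rewrite /nu_tilde oneN1 eqxx addrC mul1r scaleNr.
- do 5!eexists; split.
    rewrite alpha_hyp beta_hyp; apply: angular_minus => //.
    + by move=> t; rewrite mul1r; exact: cosh_derive.
    + exact: sinh_derive.
    + exact: cosh_sqr.
    + exact: tame_hyp.1.
    + exact: tame_hyp.2.
    + by exists 0; rewrite /cosh oppr0 expR0; field.
  by move=> P Q R b q; rewrite /nu_tilde oneN1 eq_sym oneN1 addrC scaleNr.
- do 5!eexists; split.
    rewrite alpha_circ beta_circ; apply: angular_plus => //.
    + by move=> t; rewrite mulN1r; exact: is_derive_cos.
    + by move=> t; rewrite mulN1r -!expr2 cos2sin2.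
    + exact: tame_circ.1.
    + exact: tame_circ.2.
    + exists (pi / 2); rewrite sin_pihalf oner_eq0; split=> //.
      by rewrite (_ : _ + _ = -1) ?oppr_eq0 ?oner_eq0//; ring.
  by move=> P Q R b q; rewrite /nu_tilde !eqxx mulN1r opprK.
- do 5!eexists; split.
    rewrite alpha_circ beta_circ; apply: angular_minus => //.
    + by move=> t; rewrite mulN1r; exact: is_derive_cos.
    + by move=> t; rewrite mulN1r -!expr2 cos2sin2.
    + exact: tame_circ.1.
    + exact: tame_circ.2.
    + by exists 0; exact: cos0.
  by move=> P Q R b q; rewrite /nu_tilde eqxx eq_sym oneN1 scaleNr.
Qed.

Theorem theorem1 (K : realType) (e1 e2 : K)
    (he1 : e1 = 1 \/ e1 = -1) (he2 : e2 = 1 \/ e2 = -1)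
    (f : 'rV[K]_2 -> K) (F : 'rV[K]_2 * 'rV[K]_3 -> K)
    (hf : smooth_germ f) (hf0 : f 0 = 0) (hF0 : F 0 = 0)
    (hfD4 : R_equivalent f (D4_germ e1))
    (hF : Rplus_versal f F)
    (P Q R : 'rV[K]_3 -> K) (U : set 'rV[K]_2) (x y : 'rV[K]_2 -> K)
    (hb : bif_parametrization e1 e2 F P Q R U x y) :
  let b := bmap x y in
  let n := nu e1 e2 P Q R b in
  exists (V : set 'rV[K]_2) (k1 k2 : 'rV[K]_2 -> K) (D1 D2 : 'rV[K]_2 -> 'M[K]_2),
    [/\ axis_nbhd e1 V /\ V `<=` U,
        periodic_on e1 V k1 /\ periodic_on e1 V k2,
        forall q, V q -> regular_point b q ->
          principal_curvatures b n q (k1 q) (k2 q),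
        smooth_on V k2 &
        forall W : set 'rV[K]_2, axis_nbhd e1 W ->
          forall M : K, exists q,
            [/\ V q, W q, regular_point b q & M < `|k1 q|]] /\
    [/\ smooth_direction_field e1 V D1, smooth_direction_field e1 V D2 &
        forall q, V q -> regular_point b q ->
          (D1 q == eigenspace (shape_operator b n q) (k1 q))%MS /\
          (D2 q == eigenspace (shape_operator b n q) (k2 q))%MS].
Proof.
have [hN _ hS] := hb; have [A [hA0 sP sQ sR]] := normal_coefs_domain hN.
have [n1 [n2 [la [dn1 [dn2 [hA hnu]]]]]] := angular_normal he1 he2.
by apply: (principal_data hN hA0 sP sQ sR hS hA) => q; exact: hnu.
Qed.
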